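(* Let $\mathbf{X}$ be a Hausdorff locally convex space, $Z$ a densely defined linear operator in $\mathbf{X}$ and $t>0$. Assume that there exists a function $F\in\mathcal{F}_{\mathbf{X}}$ such that $\mathcal{D}(F'_{ef}(0))\supset\mathcal{D}(Z)$ and $F'_{ef}(0)g=Zg$ for $g\in\mathcal{D}(Z)$. Let $l>0$ and $h\in\mathcal{D}(\overline{Z})$. Then the local solution $f:[0,l)\to\mathbf{X}$ of the system $$f'(v)=\overline{Z}f(v),\qquad f(0)=h,$$ exists on the semi-interval $[0,l)$ if and only if the following conditions are satisfied: (a) for any $s\in[0,l)$, every subsequence of the sequence $\{F(\tfrac tn)^{[ns/t]}h\}_{n\in\mathbb{N}}$ has a convergent subsequence; (b) for any $s\in[0,l)$ there exists a sequence $\{f_n^s\}_{n=1}^\infty$, $f_n^s\in\mathcal{D}(\overline{Z})$, such that $w\text{-}\lim_{n\to\infty}\left(F(\tfrac tn)^{[ns/t]}h-f_n^s\right)=0$ and every subsequence of the sequence $\{\overline{Z}f_n^s\}_{n\in\mathbb{N}}$ has a weakly convergent subsequence. Moreover, if conditions (a)–(b) are satisfied, then $f(v)=\lim_{n\to\infty}F(v/n)^nh$ for $v\in[0,l)$.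
   Context: $\mathbf{X}$ is over $\mathbb{T}\in\{\mathbb{R},\mathbb{C}\}$ with topology generated by semi-norms $\|\cdot\|_\alpha$, $\alpha\in\Omega$. $\mathcal{L}(\mathbf{X})$ is the space of bounded linear operators in $\mathbf{X}$ with the topology of pointwise convergence; $I$ is the identity; $\mathcal{D}(C)$ is the domain of $C$; $[\cdot]$ is the integer part; $w\text{-}\lim$ is the limit in the weak topology $\sigma(\mathbf{X},\mathbf{X}^* )$. A family $G_\beta\in\mathcal{L}(\mathbf{X})$, $\beta\in\Gamma$, is equicontinuous if for any $\alpha\in\Omega$ there are finitely many $\alpha_1,\dots,\alpha_n\in\Omega$ and $b_1,\dots,b_n>0$ with $\sup_\beta\|G_\beta x\|_\alpha\le\sum_i b_i\|x\|_{\alpha_i}$ for all $x\in\mathbf{X}$. For $F:[0,\infty)\to\mathcal{L}(\mathbf{X})$ and $s\ge0$ put $\mathbf{B}^F_s=\{F(\tfrac dn)^m : md/n\le s,\ n,m\in\mathbb{N},\ d\ge0\}$. $\mathcal{E}_{\mathbf{X}}$ is the set of $F:[0,\infty)\to\mathcal{L}(\mathbf{X})$ with $F(0)=I$ and $\mathbf{B}^F_s$ equicontinuous for every $s\ge0$. Many-valued effective derivative: $\mathcal{D}(F'_{mef}(0))$ is the set of $f\in\mathbf{X}$ for which there is a family $\{f_s\}_{s\ge0}$ in $\mathbf{X}$ such that $\lim_{h\to0}f_h=f$ and $\lim_{h\to0}h^{-1}(F(h)-F(0))f_h$ exists (limits as $h\to 0$, $h>0$); $F'_{mef}(0)f$ is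 the set of all $g\in\mathbf{X}$ arising as the second limit for some such family. $\mathcal{F}_{\mathbf{X}}$ is the set of $F\in\mathcal{E}_{\mathbf{X}}$ with $\mathcal{D}(F'_{mef}(0))$ dense in $\mathbf{X}$. For $F\in\mathcal{F}_{\mathbf{X}}$ each $F'_{mef}(0)f$ consists of one element, and the effective derivative $F'_{ef}(0):\mathcal{D}(F'_{mef}(0))\to\mathbf{X}$ is the linear map with $F'_{ef}(0)f\in F'_{mef}(0)f$. A linear operator is closable if the closure of its graph in $\mathbf{X}\times\mathbf{X}$ is the graph of a linear operator, its closure $\overline{Z}$; an operator $Z$ as in the claim is closable. A function $g:[0,l)\to\mathbf{X}$, $l>0$, is a local solution of $f'=\overline{Z}f$ on $[0,l)$, $f(0)=h\in\mathcal{D}(\overline{Z})$, if $g(s)\in\mathcal{D}(\overline{Z})$ for all $s\in[0,l)$, $g(0)=h$, and $g'(s)=\overline{Z}g(s)$ for all $s\in[0,l)$ (one-sided derivative at $0$). *)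

(* Defs.v *)
From HB Require Import structures.
From mathcomp Require Import all_boot all_order all_algebra.
From mathcomp Require Import all_classical all_reals all_analysis.
From mathcomp Require Import complex.

Set Implicit Arguments.
Unset Strict Implicit.
Unset Printing Implicit Defensive.

Import Order.TTheory GRing.Theory Num.Theory.
Import numFieldNormedType.Exports.

Local Open Scope classical_set_scope.
Local Open Scope ring_scope.

Variant scalar_kind := real_scalars | complex_scalars.

Definition scalars (R : realType) (k : scalar_kind) : numFieldType :=
  match k with
  | real_scalars => R
  | complex_scalars => R[i]
  end.

Definition of_real (R : realType) (k : scalar_kind) : R -> scalars R k :=
  match k with
  | real_scalars => id
  | complex_scalars => fun x => real_complex R x
  end.

Section LocallyConvex.
Variables (R : realType) (k : scalar_kind) (X : tvsType (scalars R k)).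

(* Nonnegativity of [q] follows from these two clauses. *)
Definition seminorm (q : X -> R) :=
  (forall x y, q (x + y) <= q x + q y) /\
  (forall (a : scalars R k) x,
     of_real k (q (a *: x)) = `|a| * of_real k (q x)).

(* The topology of [X] is the one generated by the seminorms [p a]: finite
   intersections of [p]-balls form a neighbourhood basis. *)
Definition generating_seminorms (Omega : Type) (p : Omega -> X -> R) :=
  (forall a, seminorm (p a)) /\
  (forall (x : X) (U : set X), nbhs x U <->
     exists n (a : 'I_n -> Omega) (e : R),
       0 < e /\ [set y | forall i, p (a i) (y - x) < e] `<=` U).

(* Equicontinuity is phrased with seminorms instead of the library's
   [equicontinuous] because the uniformity carried by a [tvsType] is not required
   to be translation invariant. *)
Definition seminorm_equicontinuous (Omega : Type) (p : Omega -> X -> R)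
    (B : set (X -> X)) :=
  forall a, exists n (a' : 'I_n -> Omega) (b : 'I_n -> R),
    (forall i, 0 < b i) /\
    (forall G, B G -> forall x, p a (G x) <= \sum_(i < n) b i * p (a' i) x).

Definition dual :=
  {phi : {linear X -> (scalars R k)^o} | continuous (phi : X -> (scalars R k)^o)}.

Definition evaluation (x : X) : {ptws dual -> (scalars R k)^o} :=
  fun phi => sval phi x.

(* [X] endowed with the topology sigma(X, dual). *)
Definition weak_topology := initial_topology evaluation.

Definition weak_cvg (u : nat -> X) (x : X) :=
  (u : nat -> weak_topology) @ \oo --> (x : weak_topology).

Definition increasing_index (phi : nat -> nat) :=
  forall m n, (m < n)%N -> (phi m < phi n)%N.

(* [conv] is topological or weak convergence. *)
Definition subsequentially_compact (conv : (nat -> X) -> X -> Prop)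
    (u : nat -> X) :=
  forall phi, increasing_index phi ->
    exists psi, increasing_index psi /\ exists x, conv (u \o phi \o psi) x.

Definition strong_cvg (u : nat -> X) (x : X) := u @ \oo --> x.

(* The values of [op_fun] outside [op_dom] are irrelevant. *)
Record partial_operator := PartialOperator {
  op_dom : set X;
  op_fun :> X -> X }.

Definition linear_operator (Z : partial_operator) :=
  op_dom Z 0 /\
  (forall (a : scalars R k) x y, op_dom Z x -> op_dom Z y ->
     op_dom Z (a *: x + y) /\ Z (a *: x + y) = a *: Z x + Z y).

Definition op_graph (Z : partial_operator) : set (X * X) :=
  [set xy | op_dom Z xy.1 /\ xy.2 = Z xy.1].

(* The operator whose graph is the closure of the graph of [Z]; meaningful when
   [Z] is closable, that is, when [xget] chooses in a singleton. *)
Definition op_closure (Z : partial_operator) : partial_operator :=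
  PartialOperator
    [set x | exists y, closure (op_graph Z) (x, y)]
    (fun x => xget 0 [set y | closure (op_graph Z) (x, y)]).

(* A function [0, oo) -> L(X) is represented by [F : R -> {linear X -> X}], of
   which only the values at nonnegative reals are used. *)

Definition power_family (F : R -> {linear X -> X}) (s : R) : set (X -> X) :=
  [set G | exists (n m : nat) (d : R), [/\ (0 < n)%N, (0 < m)%N, 0 <= d,
     m%:R * d / n%:R <= s & G = iter m (F (d / n%:R))]].

(* The class E_X. The first clause says that [F] takes values in L(X); in this
   class it also follows from the third one, since [F s] is in
   [power_family F s] (n = m = 1), so reading "bounded" as "continuous" or as
   "mapping bounded sets to bounded sets" yields the same class. *)
Definition chernoff_bounded (Omega : Type) (p : Omega -> X -> R)
    (F : R -> {linear X -> X}) :=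
  [/\ forall s, 0 <= s -> continuous (F s : X -> X),
      forall x, F 0 x = x &
      forall s, 0 <= s -> seminorm_equicontinuous p (power_family F s)].

(* The set F'_mef(0) f *)
Definition mv_effective_derivative (F : R -> {linear X -> X}) (f : X) : set X :=
  [set g | exists fs : R -> X,
     fs h @[h --> 0^'+] --> f /\
     (of_real k h)^-1 *: (F h (fs h) - F 0 (fs h)) @[h --> 0^'+] --> g].

(* F'_ef(0); for [F] in the class F_X the [xget] chooses in a singleton. *)
Definition effective_derivative (F : R -> {linear X -> X}) : partial_operator :=
  PartialOperator
    [set f | mv_effective_derivative F f !=set0]
    (fun f => xget 0 (mv_effective_derivative F f)).

(* The class F_X *)
Definition chernoff_function (Omega : Type) (p : Omega -> X -> R)
    (F : R -> {linear X -> X}) :=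
  chernoff_bounded p F /\ dense (op_dom (effective_derivative F)).

(* [f] solves f' = A f on [0, l) with f(0) = h; the difference quotient at [s]
   only uses points of [0, l), so the derivative at [0] is one-sided and the
   values of [f] outside [0, l) are irrelevant. *)
Definition local_solution (A : partial_operator) (l : R) (h : X) (f : R -> X) :=
  f 0 = h /\
  (forall s, 0 <= s < l ->
     op_dom A (f s) /\
     (of_real k e)^-1 *: (f (s + e) - f s)
       @[e --> within [set e | 0 <= s + e < l] 0^'] --> A (f s)).

(* The sequence F(t/n)^[ns/t] h, n = 1, 2, ... (shifted to start at index 0). *)
Definition chernoff_sequence (F : R -> {linear X -> X}) (t s : R) (h : X)
    (n : nat) : X :=
  iter (Num.truncn (n.+1%:R * s / t)) (F (t / n.+1%:R)) h.

End LocallyConvex.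

(* Main.v *)
(* Write [tau = t / n].  Equicontinuity turns approximations of a pair [(x, y)] in
   the closure of the graph of [Z] into the estimate
     [F(tau)^(i+m) x - F(tau)^i x = m tau (F(tau)^j y + small)],  [i <= j <= i + m],
   uniformly for [m tau] small.
   - It makes [Z] closable.
   - If [f] is a solution, it bounds the increments of
     [s |-> F(tau)^[(T-s)/tau] (f s)] by [small * (c - b)] on intervals [[b, c]]
     around each point; the limit superior over [tau] of these increments is
     subadditive, so that a supremum argument gives [F(tau)^[T/tau] h --> f T]
     although [f'] need not be continuous.
   - Conversely, a diagonal subsequence of the orbits converges at all rational
     times, hence everywhere by equicontinuity and (a).  The limit [f s] lies in
     the domain of the closure of [Z] by (b), because the weak and strong
     closures of a subspace agree.  The estimate for [(h, Zh)] compared with the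
     one for [(f s, Z (f s))] shows that [F(tau)^[s/tau] (Zh) --> Z (f s)], and
     then its limit is the two-sided differentiability of [f]. *)

From HB Require Import structures.
Require Import Defs.
From mathcomp Require Import all_boot all_order all_algebra.
From mathcomp Require Import all_classical all_reals all_analysis.
From mathcomp Require Import complex ring lra.

Set Implicit Arguments.
Unset Strict Implicit.
Unset Printing Implicit Defensive.

Import Order.TTheory GRing.Theory Num.Theory.
Import numFieldNormedType.Exports.

Local Open Scope classical_set_scope.
Local Open Scope ring_scope.

(** * Scalars and the Hahn-Banach theorem *)

Section OfReal.
Variables (R : realType) (k : scalar_kind).

Lemma of_real0 : of_real k (0 : R) = 0. Proof. by case: k. Qed.

Lemma of_real1 : of_real k (1 : R) = 1. Proof. by case: k. Qed.

Lemma of_realD (x y : R) : of_real k (x + y) = of_real k x + of_real k y.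
Proof. by case: k => //=; rewrite rmorphD. Qed.

Lemma of_realN (x : R) : of_real k (- x) = - of_real k x.
Proof. by case: k => //=; rewrite rmorphN. Qed.

Lemma of_realM (x y : R) : of_real k (x * y) = of_real k x * of_real k y.
Proof. by case: k => //=; rewrite rmorphM. Qed.

Lemma of_realV (x : R) : of_real k x^-1 = (of_real k x)^-1.
Proof. by case: k => //=; rewrite fmorphV. Qed.

Lemma ler_of_real (x y : R) : (of_real k x <= of_real k y) = (x <= y).
Proof. by case: k => //=; rewrite lecR. Qed.

Lemma normr_of_real (x : R) : `|of_real k x| = of_real k `|x|.
Proof. by case: k => //=; rewrite normc_def /= expr0n addr0 sqrtr_sqr. Qed.

Lemma of_real_inj : injective (@of_real R k).
Proof. by move=> x y exy; apply/le_anti; rewrite -!ler_of_real exy lexx. Qed.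

Lemma ltr_of_real (x y : R) : (of_real k x < of_real k y) = (x < y).
Proof. by rewrite !lt_neqAle ler_of_real (inj_eq of_real_inj). Qed.

(** A positive element of [R[i]] has zero imaginary part, so the radii met in scalar-valued limits
    may be taken real. *)
Lemma gt0_of_real (e : scalars R k) : 0 < e -> exists2 r : R, 0 < r & of_real k r = e.
Proof.
move: e; case: k => [e e0|e e0]; first by exists e.
have er : e = real_complex R (complex.Re e).
  by case: e e0 => a b; rewrite ltcE /= => /andP[/eqP -> _].
exists (complex.Re e); last by rewrite [RHS]er.
by rewrite -ltcR -[X in _ < X]er.
Qed.

End OfReal.

(** * Real-linear Hahn-Banach extension *)

Section HahnBanach.
Variables (R : realType) (k : scalar_kind) (V : lmodType (scalars R k)).
Variable Q : V -> R.
Hypothesis QD : forall x y, Q (x + y) <= Q x + Q y.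
Hypothesis QZ : forall (r : R) x, 0 <= r -> Q (of_real k r *: x) = r * Q x.

(** Partial functionals are encoded by their graphs, which Zorn's lemma orders by inclusion.
    Coefficients are real even when [V] is complex. *)
Definition linear_relation (G : set (V * R)) :=
  forall (a : R) v w, G v -> G w ->
    G (of_real k a *: v.1 + w.1, a * v.2 + w.2).

Definition dominated_relation (G : set (V * R)) :=
  forall v, G v -> v.2 <= Q v.1.

(* Extending by [x0] needs a value [c] with
   [r - Q (y - x0) <= c <= Q (y + x0) - r] for all [(y, r)] in the graph;
   the supremum of the left-hand sides is one. *)
Lemma dominated_extension G x0 : G (0, 0) ->
  linear_relation G -> dominated_relation G ->
  exists c : R, let G' := [set v | exists a w, G w /\
      v = (w.1 + of_real k a *: x0, w.2 + a * c)] in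
    linear_relation G' /\ dominated_relation G'.
Proof.
move=> G0 linG domG.
have key v w : G v -> G w -> v.2 - Q (v.1 - x0) <= Q (w.1 + x0) - w.2.
  move=> Gv Gw; have := domG _ (linG 1 _ _ Gv Gw).
  rewrite /= of_real1 scale1r mul1r => /le_trans le.
  have := QD (v.1 - x0) (w.1 + x0).
  rewrite addrACA addNr addr0 => /le; lra.
pose S := [set r | exists2 v, G v & r = v.2 - Q (v.1 - x0)].
have Subd w : G w -> ubound S (Q (w.1 + x0) - w.2).
  by move=> Gw _ [v Gv ->]; exact: key.
have S0 : S !=set0 by exists (0 - Q (0 - x0)), (0, 0).
exists (sup S); set c := sup S.
have lec v : G v -> v.2 - Q (v.1 - x0) <= c.
  move=> Gv; apply: ub_le_sup; last by exists v.
  by exists (Q (0 + x0) - 0); exact: (Subd _ G0).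
have cle w : G w -> c <= Q (w.1 + x0) - w.2.
  by move=> Gw; apply: ge_sup => //; exact: Subd.
have GZ (a : R) w : G w -> G (of_real k a *: w.1, a * w.2).
  by move=> Gw; have := linG a _ _ Gw G0; rewrite /= !addr0.
split.
  move=> a _ _ [b [v [Gv ->]]] [b' [w [Gw ->]]] /=.
  exists (a * b + b'), (of_real k a *: v.1 + w.1, a * v.2 + w.2).
  split; first exact: linG.
  congr (_, _) => /=; last by ring.
  by rewrite of_realD of_realM scalerDl scalerDr -scalerA addrACA.
move=> _ [a [w [Gw ->]]] /=.
(* Dividing by [|a|] reduces the two nonzero cases to the coefficients 1 and -1 of [x0], which [cle]
   and [lec] settle. *)
have [a0|a0|->] := ltrgtP a 0; last first.
- by rewrite of_real0 scale0r mul0r !addr0; exact: domG.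
- have /cle/= := GZ a^-1 _ Gw.
  have -> : w.1 + of_real k a *: x0 = of_real k a *: (of_real k a^-1 *: w.1 + x0).
    by rewrite scalerDr scalerA -of_realM mulfV ?gt_eqF// of_real1 scale1r.
  rewrite QZ; last exact: ltW. move=> h.
  rewrite -(ler_pM2l a0) in h.
  have -> : w.2 = a * (a^-1 * w.2) by rewrite mulrA mulfV ?mul1r// gt_eqF.
  by rewrite addrC -lerBrDr -mulrBr.
- have b0 : 0 < - a by rewrite oppr_gt0.
  have /lec/= := GZ (- a)^-1 _ Gw.
  have -> : w.1 + of_real k a *: x0
      = of_real k (- a) *: (of_real k (- a)^-1 *: w.1 - x0).
    rewrite scalerBr scalerA -of_realM mulfV ?gt_eqF// of_real1 scale1r.
    by rewrite of_realN scaleNr opprK.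
  rewrite QZ; last exact: ltW. move=> h.
  rewrite -(ler_pM2l b0) in h.
  have e : w.2 = - a * ((- a)^-1 * w.2) by rewrite mulrA mulfV ?mul1r// gt_eqF.
  move: h; rewrite mulrBr -e; lra.
Qed.

Theorem hahn_banach (G : set (V * R)) : G (0, 0) ->
  linear_relation G -> dominated_relation G ->
  exists f : V -> R, [/\ forall (a : R) x y,
      f (of_real k a *: x + y) = a * f x + f y,
    forall x, f x <= Q x & forall v, G v -> f v.1 = v.2].
Proof.
move=> G0 linG domG.
pose P H := H = set0 \/ [/\ G `<=` H, linear_relation H & dominated_relation H].
have [|M [PM maxM]] := @Zorn_bigcup _ P.
  move=> C CP totC.
  have [[H CH H0]|none] := pselect (exists2 H, C H & H !=set0); last first.
    left; apply/seteqP; split=> // v [H CH Hv]; apply: none.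
    by exists H => //; exists v.
  have prop K v : C K -> K v ->
      [/\ G `<=` K, linear_relation K & dominated_relation K].
    by move=> CK Kv; case: (CP _ CK) => // K0; rewrite K0 in Kv.
  right; split.
  - by move=> v Gv; exists H => //; case: H0 => w /(prop _ _ CH)[+ _ _]; exact.
  - move=> a v w [K CK Kv] [L CL Lw].
    case: (totC _ _ CK CL) => [KL|LK].
      by exists L => //; case: (prop _ _ CL Lw) => _ + _; apply=> //; exact: KL.
    by exists K => //; case: (prop _ _ CK Kv) => _ + _; apply=> //; exact: LK.
  - by move=> v [K CK Kv]; case: (prop _ _ CK Kv) => _ _; exact.
have [GM linM domM] : [/\ G `<=` M, linear_relation M & dominated_relation M].
  case: PM => // M0; exfalso; apply: (maxM G); last by right; split.
  by rewrite M0; split=> // /(_ _ G0).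
have M00 := GM _ G0.
(* The difference of two values at [x] is a value at 0, hence at most [Q 0 = 0]; exchanging the two
   gives equality. *)
have Mfun x r s : M (x, r) -> M (x, s) -> r = s.
  have le r' s' : M (x, r') -> M (x, s') -> s' <= r'.
    move=> Mr Ms; have := domM _ (linM (-1) _ _ Mr Ms).
    rewrite /= of_realN of_real1 scaleN1r addNr.
    have -> : Q 0 = 0 by rewrite -(scale0r 0) -(of_real0 R k) QZ ?mul0r.
    by rewrite mulN1r addrC subr_le0 => h; exact: h.
  by move=> Mr Ms; apply/le_anti/andP; split; exact: le.
have Mtot x : exists r, M (x, r).
  apply: contrapT => nx.
  have [c /=] := dominated_extension x M00 linM domM.
  set G' := (X in linear_relation X) => -[linG' domG'].
  have MG' : M `<=` G'.
    move=> v Mv; exists 0, v; split=> //.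
    by rewrite of_real0 scale0r mul0r !addr0; case: v {Mv}.
  apply: (maxM G'); last by right; split=> //; exact: subset_trans MG'.
  split=> // /(_ (x, c)) Mx; apply: nx; exists c; apply: Mx.
  by exists 1, (0, 0); split=> //=; rewrite of_real1 scale1r mul1r !add0r.
have [f fM] := choice Mtot.
exists f; split.
- move=> a x y; apply: (Mfun (of_real k a *: x + y)) => //.
  exact: (linM a _ _ (fM x) (fM y)).
- by move=> x; have /= := domM _ (fM x).
- by move=> [x r] /GM Mv /=; exact: Mfun Mv.
Qed.

End HahnBanach.

Lemma real_linear_rules (R : realType) k (V : lmodType (scalars R k)) (f : V -> R) :
  (forall (a : R) x y, f (of_real k a *: x + y) = a * f x + f y) ->
  [/\ forall x y, f (x + y) = f x + f y, forall x, f (- x) = - f x &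
      forall r x, f (of_real k r *: x) = r * f x].
Proof.
move=> flin; have f0 : f 0 = 0.
  by have := flin 1 0 0; rewrite of_real1 scale1r addr0 mul1r; lra.
have fZ r x : f (of_real k r *: x) = r * f x.
  by have := flin r x 0; rewrite !addr0 f0 addr0.
split=> // [x y|x]; first by have := flin 1 x y; rewrite of_real1 scale1r mul1r.
by rewrite -scaleN1r -(of_real1 R k) -of_realN fZ mulN1r.
Qed.

(** * Seminorms *)

Section Seminorms.
Variables (R : realType) (k : scalar_kind) (X : tvsType (scalars R k)).
Implicit Types (q : X -> R) (x y : X).

Lemma seminormZ q (r : R) x : seminorm q -> q (of_real k r *: x) = `|r| * q x.
Proof.
move=> [_ qZ]; apply: (@of_real_inj R k).
by rewrite qZ normr_of_real of_realM.
Qed.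

Lemma seminorm0 q : seminorm q -> q 0 = 0.
Proof.
by move=> qs; rewrite -(scale0r 0) -(of_real0 R k) seminormZ // normr0 mul0r.
Qed.

Lemma seminormN q x : seminorm q -> q (- x) = q x.
Proof.
move=> qs; rewrite -scaleN1r -(of_real1 R k) -of_realN seminormZ //.
by rewrite normrN normr1 mul1r.
Qed.

Lemma seminorm_ge0 q x : seminorm q -> 0 <= q x.
Proof.
move=> qs; have := qs.1 x (- x); rewrite subrr seminorm0 // seminormN //; lra.
Qed.

(* Testing a seminorm estimate on a functional norming the left-hand side turns
   it into linear arithmetic over [R]. *)
Lemma norming_functional q w : seminorm q -> exists f : X -> R,
  [/\ forall x y, f (x + y) = f x + f y, forall x, f (- x) = - f x,
      forall r x, f (of_real k r *: x) = r * f x,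
      forall x c, q x <= c -> - c <= f x <= c & f w = q w].
Proof.
move=> qs; pose G := [set v : X * R | exists a, v = (of_real k a *: w, a * q w)].
have QZ (r : R) x : 0 <= r -> q (of_real k r *: x) = r * q x.
  by move=> r0; rewrite seminormZ // ger0_norm.
have G0 : G (0, 0) by exists 0; rewrite of_real0 scale0r mul0r.
have linG : linear_relation G.
  move=> a v w' [b ->] [c ->]; exists (a * b + c) => /=.
  by rewrite of_realD of_realM scalerDl scalerA mulrDl mulrA.
have domG : dominated_relation q G.
  move=> v [a ->] /=; rewrite seminormZ // ler_wpM2r ?seminorm_ge0 //.
  exact: ler_norm.
have [f [flin fq fG]] := hahn_banach qs.1 QZ G0 linG domG.
have [fD fN fZ] := real_linear_rules flin.
exists f; split=> //.
- move=> x c qc; rewrite lerNl -fN !(le_trans (fq _)) //.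
  by rewrite seminormN.
- by have := fG (w, q w); apply; exists 1; rewrite of_real1 scale1r mul1r.
Qed.

(** These seminorms are stable under finite sums, so a single one replaces each finite family coming
    from the neighbourhood basis or from equicontinuity. *)
Definition continuous_seminorm q :=
  seminorm q /\ forall x (e : R), 0 < e -> nbhs x [set y | q (y - x) < e].

Lemma continuous_seminormD q q' : continuous_seminorm q ->
  continuous_seminorm q' -> continuous_seminorm (fun x => q x + q' x).
Proof.
move=> [qs qn] [qs' qn']; split; first split.
- by move=> x y; rewrite addrACA lerD ?qs.1 ?qs'.1.
- by move=> a x; rewrite !of_realD mulrDr qs.2 qs'.2.
- move=> x e e0; have e2 : 0 < e / 2 by lra.
  apply: filterS (filterI (qn x _ e2) (qn' x _ e2)) => y [/=]; lra.
Qed.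

Lemma continuous_seminorm_scale q c : 0 < c -> continuous_seminorm q ->
  continuous_seminorm (fun x => c * q x).
Proof.
move=> c0 [qs qn]; split; first split.
- by move=> x y; rewrite -mulrDr ler_pM2l // qs.1.
- by move=> a x; rewrite !of_realM qs.2 mulrCA.
- move=> x e e0; have ec : 0 < e / c by rewrite divr_gt0.
  by apply: filterS (qn x _ ec) => y /=; rewrite ltr_pdivlMr // mulrC.
Qed.

Lemma continuous_seminorm0 : continuous_seminorm (fun=> 0).
Proof.
split; first by split=> [x y|a x]; rewrite ?addr0 // of_real0 mulr0.
by move=> x e e0; apply: filterS filterT => y /=.
Qed.

Lemma continuous_seminorm_sum n (q : 'I_n -> X -> R) :
  (forall i, continuous_seminorm (q i)) ->
  continuous_seminorm (fun x => \sum_(i < n) q i x).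
Proof.
elim: n q => [|n IH] q qs.
  rewrite (_ : (fun _ => _) = fun=> 0); first exact: continuous_seminorm0.
  by apply/funext => x; rewrite big_ord0.
rewrite (_ : (fun _ => _) =
    fun x => \sum_(i < n) q (widen_ord (leqnSn n) i) x + q ord_max x).
  by apply: continuous_seminormD => //; exact: IH.
by apply/funext => x; rewrite big_ord_recr.
Qed.

Lemma continuous_seminorm_cvg (T : Type) (G : set_system T) (FG : Filter G)
    (f : T -> X) x q (e : R) : continuous_seminorm q -> f @ G --> x -> 0 < e ->
  \forall n \near G, q (f n - x) < e.
Proof. by move=> [_ qn] fx e0; exact: (fx _ (qn x _ e0)). Qed.

(** * Topologies generated by seminorms *)

Section Generated.
Variables (Omega : Type) (p : Omega -> X -> R).
Hypothesis pX : generating_seminorms p.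

Lemma generating_continuous a : continuous_seminorm (p a).
Proof.
split=> [|x e e0]; first exact: pX.1.
by apply/pX.2; exists 1%N, (fun=> a), e; split=> // y; apply; exact: ord0.
Qed.

Lemma nbhs_seminorm x (U : set X) : nbhs x U ->
  exists q (e : R), [/\ continuous_seminorm q, 0 < e &
    [set y | q (y - x) < e] `<=` U].
Proof.
move=> /pX.2 [n [a [e [e0 eU]]]].
exists (fun x => \sum_(i < n) p (a i) x), e; split=> //.
  by apply: continuous_seminorm_sum => i; exact: generating_continuous.
move=> y /= ye; apply: eU => i; apply: le_lt_trans ye.
rewrite (bigD1 i) //= lerDl sumr_ge0 // => j _.
by apply: seminorm_ge0; exact: pX.1.
Qed.

Lemma seminorm_cvg (T : Type) (G : set_system T) (FG : Filter G)
    (f : T -> X) x :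
  (forall a (e : R), 0 < e -> \forall n \near G, p a (f n - x) < e) -> f @ G --> x.
Proof.
move=> H U /pX.2 [n [a [e [e0 eU]]]].
rewrite nbhs_filterE /=.
have : \forall y \near G, forall i : 'I_n, p (a i) (f y - x) < e.
  by apply: filter_forall => i; exact: H.
by apply: filterS => y ye; apply: eU.
Qed.

Lemma seminorm_eq : hausdorff_space X -> forall x y,
  (forall a (e : R), 0 < e -> p a (x - y) < e) -> x = y.
Proof.
move=> hX x y H; apply: hX => A B nA nB.
move: nB => /pX.2 [n [a [e [e0 eU]]]].
exists x; split; first exact: nbhs_singleton.
by apply: eU => i; exact: H.
Qed.

(** A single [q] serves both coordinates: the sum of the two seminorms given by a product
    neighbourhood dominates each of them. *)
Lemma closure_prodP (G : set (X * X)) x y :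
  closure G (x, y) <-> forall q (e : R), continuous_seminorm q -> 0 < e ->
    exists x' y', [/\ G (x', y'), q (x' - x) < e & q (y' - y) < e].
Proof.
split=> [clG q e qc e0|H U [[U1 U2] [/= n1 n2] U12]].
  have := clG [set z | q (z.1 - x) < e /\ q (z.2 - y) < e].
  case=> [|[x' y'] [Gz [/= h1 h2]]]; last by exists x', y'.
  exists ([set z | q (z - x) < e], [set z | q (z - y) < e]) => /=.
    by split; exact: qc.2.
  by move=> [z1 z2].
have [q1 [e1 [qc1 e10 h1]]] := nbhs_seminorm n1.
have [q2 [e2 [qc2 e20 h2]]] := nbhs_seminorm n2.
have [|x' [y' [Gz hx hy]]] :=
    H _ (Num.min e1 e2) (continuous_seminormD qc1 qc2).
  by rewrite lt_min e10.
exists (x', y'); split=> //; apply: U12; split=> /=.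
- apply: h1 => /=; move: hx; rewrite lt_min => /andP[+ _].
  by apply: le_lt_trans; rewrite lerDl seminorm_ge0 //; exact: qc2.1.
- apply: h2 => /=; move: hy; rewrite lt_min => /andP[_ ].
  by apply: le_lt_trans; rewrite lerDr seminorm_ge0 //; exact: qc1.1.
Qed.

End Generated.
End Seminorms.

(** * Weak closures *)

Section Duality.
Variable R : realType.

Lemma linear_bundle (K : pzRingType) (U V : lmodType K) (f : U -> V) :
  linear f -> exists g : {linear U -> V}, g =1 f.
Proof.
move=> lf; pose lM := GRing.isLinear.Build K U V _ f lf.
by exists (HB.pack_for {linear U -> V} f lM).
Qed.

(** Passes from a real-linear functional to a scalar-linear one, so that separation also works over
    the complex numbers. The factor 2 comes from bounding the real and imaginary parts
    separately. *)
Lemma scalar_functional k (V : lmodType (scalars R k)) (f : V -> R) :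
  (forall (a : R) x y, f (of_real k a *: x + y) = a * f x + f y) ->
  exists phi : {linear V -> (scalars R k)^o},
    (forall x (c : R), (forall a, `|a| = 1 -> `|f (a *: x)| <= c) ->
      `|phi x : scalars R k| <= of_real k (2 * c)) /\
    (forall x, phi x = 0 -> f x = 0).
Proof.
case: k V f => [|] V f flin.
  have [phi phiE] := @linear_bundle R V R^o f flin.
  exists phi; split=> [x c H|x]; rewrite phiE //.
  have := H 1 (normr1 _); rewrite scale1r /= => h.
  have := normr_ge0 (f x); lra.
pose i : R[i] := 'i%C.
(* This is [f x - i f (i x)], the complex-linear functional with real part [f]. *)
pose g (x : V) : R[i] := Complex (f x) (- f (i *: x)).
have [fD _ fZ] := real_linear_rules flin.
have glin : linear (g : V -> (R[i])^o).
  move=> [u v] x y; rewrite /g scalerDr scalerA !fD.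
  have -> : Complex u v *: x = of_real complex_scalars u *: x
      + of_real complex_scalars v *: (i *: x).
    rewrite scalerA -scalerDl; congr (_ *: _).
    by apply/eqP; rewrite eq_complex /=; apply/andP; split; apply/eqP; ring.
  have -> : (i * Complex u v) *: x = of_real complex_scalars (- v) *: x
      + of_real complex_scalars u *: (i *: x).
    rewrite scalerA -scalerDl; congr (_ *: _).
    by apply/eqP; rewrite eq_complex /=; apply/andP; split; apply/eqP; ring.
  rewrite !fD !fZ; apply/eqP; rewrite eq_complex /=.
  by apply/andP; split; apply/eqP; ring.
have [phi phiE] := @linear_bundle R[i] V (R[i])^o g glin.
exists phi; split=> [x c H|x]; rewrite phiE /g; last by case.
have h1 := H 1 (normr1 _); rewrite scale1r in h1.
have i1 : `|i| = 1 by rewrite normc_def /= expr0n expr1n add0r sqrtr1.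
have h2 := H i i1.
have -> : Complex (f x) (- f (i *: x)) =
    of_real complex_scalars (f x) - i * of_real complex_scalars (f (i *: x)).
  by apply/eqP; rewrite eq_complex /=; apply/andP; split; apply/eqP; ring.
apply: le_trans (ler_normB _ _) _; rewrite normrM i1 mul1r.
by rewrite !normr_of_real -of_realD ler_of_real; lra.
Qed.

Section Dual.
Variables (k : scalar_kind) (X : tvsType (scalars R k)).

Lemma bounded_functional_continuous (phi : {linear X -> (scalars R k)^o}) q :
  continuous_seminorm q ->
  (forall x, `|phi x : scalars R k| <= of_real k (q x)) ->
  continuous (phi : X -> (scalars R k)^o).
Proof.
move=> [_ qn] H x; apply/cvgrPdist_lt => e /gt0_of_real[r r0 <-].
apply: filterS (qn x r r0) => y /= qy.
rewrite distrC -linearB; apply: le_lt_trans (H _) _.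
by rewrite ltr_of_real.
Qed.

Lemma initial_cvgP (S : choiceType) (T : topologicalType) (f : S -> T)
    (G : set_system S) (FG : Filter G) (s : S) :
  (G --> (s : initial_topology f)) <-> f @ G --> f s.
Proof.
split=> [Gs|Gs A [_ [[U oU <-] Us UA]]].
  exact: (cvg_comp id f Gs (@initial_continuous S T f s)).
by apply: (filterS UA); apply: Gs; rewrite nbhsE; exists U.
Qed.

(** The pointwise topology is a supremum of initial topologies, one for each functional, so
    convergence is tested on each of them. *)
Lemma weak_cvgP (u : nat -> X) x : weak_cvg u x <->
  forall phi : dual X, sval phi (u n) @[n --> \oo] --> (sval phi x : (scalars R k)^o).
Proof.
have FF (S : Type) (v : nat -> S) : Filter (v @ \oo) by exact: fmap_filter.
rewrite /weak_cvg (initial_cvgP _ (FF _ _)); split=> [|H].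
  by move=> /(@cvg_sup _ _ _ _ _ (FF _ _)) H phi; have /(initial_cvgP _ (FF _ _)) := H phi.
by apply/(@cvg_sup _ _ _ _ _ (FF _ _)) => phi; apply/(initial_cvgP _ (FF _ _)); exact: H.
Qed.

Lemma strong_weak_cvg (u : nat -> X) x : u @ \oo --> x -> weak_cvg u x.
Proof.
move=> ux; apply/weak_cvgP => phi.
exact: (cvg_comp u (sval phi : X -> (scalars R k)^o) ux (svalP phi x)).
Qed.

Variables (Omega : Type) (p : Omega -> X -> R).
Hypothesis pX : generating_seminorms p.

(** Separation: if [z] stays at distance at least [e > 0] from [C] for the seminorm [Q], Hahn-Banach
    gives a functional that vanishes on [C] but not at [z]; its restrictions to the two factors are
    [phi] and [psi]. *)
Lemma closure_subspace (C : set (X * X)) z : C (0, 0) ->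
  (forall (a : scalars R k) v w, C v -> C w -> C (a *: v + w)) ->
  (forall phi psi : dual X,
    (forall v, C v -> sval phi v.1 + sval psi v.2 = 0) ->
    sval phi z.1 + sval psi z.2 = 0) ->
  closure C z.
Proof.
case: z => z1 z2 C0 Clin H; apply/(closure_prodP pX) => q e qc e0.
apply: contrapT => none.
have qD := qc.1.1; have qs := qc.1.
have dist v : C v -> e <= q (z1 - v.1) + q (z2 - v.2).
  move=> Cv; rewrite leNgt; apply/negP => lt; apply: none.
  have sym w w' : q (w - w') = q (w' - w) by rewrite -seminormN // opprB.
  exists v.1, v.2; split; first by rewrite -surjective_pairing.
  - by apply: le_lt_trans lt; rewrite sym lerDl seminorm_ge0.
  - by apply: le_lt_trans lt; rewrite [leRHS]addrC sym lerDl seminorm_ge0.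
pose Q (v : X * X) := q v.1 + q v.2.
have QD v w : Q (v + w) <= Q v + Q w.
  by have := lerD (qD v.1 w.1) (qD v.2 w.2); rewrite addrACA.
have QZ (r : R) v : 0 <= r -> Q (of_real k r *: v) = r * Q v.
  by move=> r0; rewrite /Q !seminormZ // ger0_norm // mulrDr.
(* The functional to extend sends [a z + w], [w] in [C], to [a e]. For [a > 0] its domination is
   [dist] at [- w / a], multiplied by [a]; for [a <= 0] its value is nonpositive. *)
pose G := [set v : (X * X) * R | exists a w,
  C w /\ v = (of_real k a *: ((z1, z2) : X * X) + w, a * e)].
have G0 : G (0, 0).
  by exists 0, (0, 0); split=> //; rewrite of_real0 scale0r mul0r addr0.
have linG : linear_relation G.
  move=> a _ _ [b [v [Cv ->]]] [b' [w [Cw ->]]] /=.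
  exists (a * b + b'), (of_real k a *: v + w); split; first exact: Clin.
  congr (_, _); last by rewrite mulrDl mulrA.
  by rewrite of_realD of_realM scalerDl scalerDr -scalerA addrACA.
have domG : dominated_relation Q G.
  move=> _ [a [w [Cw ->]]] /=.
  have Qge0 v : 0 <= Q v by rewrite addr_ge0 ?seminorm_ge0.
  have [a0|a0] := leP a 0.
    by apply: le_trans (Qge0 _); rewrite mulr_le0_ge0 // ltW.
  have Cw' : C (- (of_real k a)^-1 *: w).
    by have := Clin (- (of_real k a)^-1) _ _ Cw C0; rewrite addr0.
  have an0 : of_real k a != 0 by rewrite -(of_real0 R k) (inj_eq (@of_real_inj R k)) gt_eqF.
  have -> : of_real k a *: ((z1, z2) : X * X) + w
      = of_real k a *: ((z1, z2) - (- (of_real k a)^-1 *: w)).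
    by rewrite scaleNr opprK scalerDr scalerA mulfV // scale1r.
  by rewrite QZ; [rewrite ler_pM2l //; exact: dist Cw'|exact: ltW].
have [f [flin fQ fG]] := hahn_banach QD QZ G0 linG domG.
have [Phi [PhiQ Phi0]] := scalar_functional flin.
have absf v : `|f v| <= Q v.
  have [_ fN _] := real_linear_rules flin.
  rewrite ler_norml fQ andbT lerNl -fN; apply: le_trans (fQ _) _.
  by rewrite /Q !seminormN.
have QZ1 (a : scalars R k) v : `|a| = 1 -> Q (a *: v) = Q v.
  move=> a1; apply: (@of_real_inj R k).
  by rewrite /Q !of_realD !qs.2 a1 !mul1r.
have Phile v : `|Phi v : scalars R k| <= of_real k (2 * Q v).
  by apply: PhiQ => a a1; apply: le_trans (absf _) _; rewrite QZ1.
(* [f] vanishes on [C], which contains all scalar multiples of [v], so the bound on [Phi v] applies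
   with [c = 0]. *)
have PhiC v : C v -> Phi v = 0.
  move=> Cv; apply/eqP; rewrite -normr_le0 -(of_real0 R k) -[X in of_real k X](mulr0 2).
  apply: PhiQ => a _; rewrite (fG (a *: v, 0)) /= ?normr0 //.
  exists 0, (a *: v); rewrite of_real0 scale0r add0r mul0r; split=> //.
  by have := Clin a _ _ Cv C0; rewrite addr0.
have l1 : linear (fun x : X => Phi (x, 0) : (scalars R k)^o).
  move=> a x y; rewrite -linearP; congr (Phi _).
  by congr (_, _); rewrite /= scaler0 addr0.
have l2 : linear (fun y : X => Phi (0, y) : (scalars R k)^o).
  move=> a x y; rewrite -linearP; congr (Phi _).
  by congr (_, _); rewrite /= scaler0 addr0.
have [phi phiE] := linear_bundle l1; have [psi psiE] := linear_bundle l2.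
have q2 := continuous_seminorm_scale (ltr0Sn R 1) qc.
have cphi : continuous (phi : X -> (scalars R k)^o).
  apply: bounded_functional_continuous q2 _ => x.
  by rewrite phiE; apply: le_trans (Phile _) _; rewrite /Q /= seminorm0 // addr0.
have cpsi : continuous (psi : X -> (scalars R k)^o).
  apply: bounded_functional_continuous q2 _ => x.
  by rewrite psiE; apply: le_trans (Phile _) _; rewrite /Q /= seminorm0 // add0r.
have PhiE v : phi v.1 + psi v.2 = Phi v.
  rewrite phiE psiE -linearD; congr (Phi _); case: v => x y.
  by congr (_, _); rewrite /= ?addr0 ?add0r.
have := H (exist _ phi cphi) (exist _ psi cpsi).
rewrite /= (PhiE (z1, z2)) => /(_ _)/Phi0 fz.
have : f (z1, z2) = e.
  apply: (fG ((z1, z2), e)); exists 1, (0, 0); split=> //.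
  by rewrite of_real1 scale1r mul1r addr0.
rewrite fz; last by move=> v Cv; rewrite PhiE PhiC.
by move=> ee; rewrite -ee ltxx in e0.
Qed.

(** A continuous functional [(phi, psi)] vanishing on [C] has a closed kernel, hence vanishes at the
    pairs [(u n, v n)] and at their weak limit; separation concludes. *)
Lemma weak_limit_closure (C : set (X * X)) (u v : nat -> X) x y : C (0, 0) ->
  (forall (a : scalars R k) v w, C v -> C w -> C (a *: v + w)) ->
  (forall n, closure C (u n, v n)) -> weak_cvg u x -> weak_cvg v y ->
  closure C (x, y).
Proof.
move=> C0 Clin Cuv ux vy; apply: closure_subspace => // phi psi H.
have cl : closure C `<=` [set z | sval phi z.1 + sval psi z.2 = 0].
  have cK : closed [set z : X * X | sval phi z.1 + sval psi z.2 = 0].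
    apply: (@closed_comp _ _ (fun z : X * X => (sval phi z.1 + sval psi z.2
      : (scalars R k)^o)) [set 0]).
      move=> z _; apply: cvgD.
        apply: (@cvg_comp _ _ _ fst (sval phi : X -> (scalars R k)^o)).
          exact: cvg_fst.
        exact: (svalP phi).
      apply: (@cvg_comp _ _ _ snd (sval psi : X -> (scalars R k)^o)).
        exact: cvg_snd.
      exact: (svalP psi).
    apply/accessible_closed_set1/hausdorff_accessible.
    exact: (@norm_hausdorff _ (scalars R k)^o).
  by move/closure_id : cK => ->; apply: closure_subset => z /H.
have h0 n : sval phi (u n) + sval psi (v n) = 0 by exact: (cl (u n, v n)).
have lim : sval phi (u n) + sval psi (v n) @[n --> \oo] -->
    (sval phi x + sval psi y : (scalars R k)^o).
  by apply: cvgD; by move/weak_cvgP: ux vy => + /weak_cvgP; auto.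
apply: (cvg_unique (@norm_hausdorff _ (scalars R k)^o) lim).
rewrite (_ : (fun _ => _) = fun=> 0); first exact: cvg_cst.
by apply/funext => n; exact: h0.
Qed.

End Dual.
End Duality.

(** * Iterates of a Chernoff function *)

Section IteratesOfLinearMaps.
Variables (R : realType) (k : scalar_kind) (X : tvsType (scalars R k)).
Implicit Types (T : {linear X -> X}) (x y : X).

Lemma iter_linearB T n x y : iter n T (x - y) = iter n T x - iter n T y.
Proof. by elim: n => //= n ->; rewrite linearB. Qed.

Lemma iter_linearZ T n a x : iter n T (a *: x) = a *: iter n T x.
Proof. by elim: n => //= n ->; rewrite linearZ. Qed.

(** Telescoping: the increment is the sum over [j < m] of [T^(i+j) (T x - x)], each term being
    [tau w] up to [tau c]. *)
Lemma seminorm_iter_increment (q : X -> R) T x w (c tau : R) i m :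
  seminorm q ->
  (forall j, (j < m)%N ->
    q (iter (i + j) T (T x - x) - of_real k tau *: w) <= tau * c) ->
  q (iter (i + m) T x - iter i T x - of_real k (m%:R * tau) *: w)
    <= m%:R * tau * c.
Proof.
move=> qs; elim: m => [|m IH] H.
  by rewrite addn0 !mul0r of_real0 scale0r subr0 subrr seminorm0.
have {}IH := IH (fun j jm => H j (ltnW jm)).
have {}H := H m (ltnSn m); move: H; rewrite iter_linearB -iterSr => H.
have [f [fD fN fZ fq <-]] := norming_functional
  (iter (i + m.+1) T x - iter i T x - of_real k (m.+1%:R * tau) *: w) qs.
have /andP[_] := fq _ _ IH; have /andP[_] := fq _ _ H.
rewrite !(fD, fN, fZ) addnS -natr1 /=; lra.
Qed.

End IteratesOfLinearMaps.

(** * Estimates uniform in the step size *)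

Section ChernoffEstimates.
Variables (R : realType) (k : scalar_kind) (X : tvsType (scalars R k)).
Variables (Omega : Type) (p : Omega -> X -> R).
Hypothesis pX : generating_seminorms p.
Variable Z : partial_operator X.
Hypothesis denseZ : dense (op_dom Z).
Variable F : R -> {linear X -> X}.
Hypothesis FX : chernoff_bounded p F.
Hypothesis ZF : forall g, op_dom Z g -> mv_effective_derivative F g (Z g).

Notation Gamma := (closure (op_graph Z)).

Lemma seminorm_stability a (S : R) : 0 <= S ->
  exists q, continuous_seminorm q /\ forall tau m, 0 < tau ->
    m%:R * tau <= S -> forall x, p a (iter m (F tau) x) <= q x.
Proof.
move=> S0; case: FX => _ _ /(_ S S0 a) [n [a' [b [b0 H]]]].
have qc : continuous_seminorm (fun x => \sum_(i < n) b i * p (a' i) x).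
  by apply: continuous_seminorm_sum => i; apply: continuous_seminorm_scale;
    [exact: b0|exact: generating_continuous].
have ac := generating_continuous pX a.
(* The added [p a x] covers [m = 0], which [power_family] excludes. *)
exists (fun x => \sum_(i < n) b i * p (a' i) x + p a x).
split; first exact: continuous_seminormD.
move=> tau [|m] tau0 mS x /=; first by rewrite lerDr (seminorm_ge0 _ qc.1).
apply: le_trans (_ : \sum_(i < n) b i * p (a' i) x <= _).
  apply: (H (iter m.+1 (F tau))); exists 1%N, m.+1, tau.
  by split; rewrite ?divr1 // ltW.
by rewrite lerDl seminorm_ge0 //; exact: ac.1.
Qed.

Lemma at_right0P (P : R -> Prop) : (\forall h \near 0^'+, P h) ->
  exists2 d : R, 0 < d & forall h, 0 < h < d -> P h.
Proof.
move=> [d /= d0 H]; exists d => // h /andP[h0 hd]; apply: H => //=.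
by rewrite sub0r normrN gtr0_norm.
Qed.

(** The effective derivative is taken along a moving family, so [x'] depends on [tau]: it is
    [fs tau] for a pair [(x1, Z x1)] of the graph near [(x, y)]. *)
Lemma approximating_family x y q e : continuous_seminorm q -> 0 < e ->
  Gamma (x, y) -> exists2 d : R, 0 < d & forall tau, 0 < tau < d ->
    exists2 x', q (x' - x) <= e &
      q (F tau x' - x' - of_real k tau *: y) <= tau * e.
Proof.
move=> qc e0 /(closure_prodP pX) H; have e2 : 0 < e / 2 by lra.
have [x1 [_ [[/= Zx1 ->] xx1 yy1]]] := H _ _ qc e2.
have [fs [fs1 fs2]] := ZF Zx1.
have FG : Filter (0^'+ : set_system R) by exact: within_filter.
have n1 := continuous_seminorm_cvg FG qc fs1 e2.
have n2 := continuous_seminorm_cvg FG qc fs2 e2.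
have [d d0 dH] := at_right0P (filterI n1 n2).
exists d => // tau td; have tau0 : 0 < tau by case/andP: td.
have [/= q1 q2] := dH _ td; exists (fs tau).
  have [f [fD fN fZ fq <-]] := norming_functional (fs tau - x) qc.1.
  have /andP[_] := fq _ _ (ltW q1); have /andP[_] := fq _ _ (ltW xx1).
  rewrite !(fD, fN); lra.
set w := F tau (fs tau) - fs tau; move: q2.
have -> : F 0 (fs tau) = fs tau by case: FX.
rewrite -/w => q2.
have -> : w - of_real k tau *: y =
    of_real k tau *: ((of_real k tau)^-1 *: w - y).
  rewrite scalerBr scalerA -of_realV -of_realM mulfV ?gt_eqF //.
  by rewrite of_real1 scale1r.
rewrite (seminormZ _ _ qc.1) gtr0_norm // ler_pM2l //.
set v := _ *: w in q2 *.
have [f [fD fN fZ fq <-]] := norming_functional (v - y) qc.1.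
have /andP[_] := fq _ _ (ltW q2); have /andP[_] := fq _ _ (ltW yy1).
rewrite !(fD, fN); lra.
Qed.

Lemma dense_approximation y q e : continuous_seminorm q -> 0 < e ->
  exists2 y', op_dom Z y' & q (y' - y) < e.
Proof.
move=> qc e0; have := qc.2 y _ e0; rewrite nbhsE => -[U [oU Uy] UH].
have [|y' [Uy' Zy']] := denseZ (O := U) _ oU; first by exists y.
by exists y' => //; exact: UH.
Qed.

(** For approximants [x'] of some [y'] in the domain of [Z], telescoping with [w = 0] bounds the
    increment by a constant times [m tau]; density of the domain and stability carry this over to
    [y]. *)
Lemma orbit_slow_variation a (S e : R) y : 0 <= S -> 0 < e ->
  exists2 d : R, 0 < d & forall tau i j, 0 < tau < d ->
    i%:R * tau <= S -> j%:R * tau <= S -> `|i%:R * tau - j%:R * tau| <= d ->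
    p a (iter i (F tau) y - iter j (F tau) y) <= e.
Proof.
move=> S0 e0; have [q [qc qS]] := seminorm_stability a S0.
have e8 : 0 < e / 8 by lra.
have [y' Zy' yy'] := dense_approximation y qc e8.
have Gy' : Gamma (y', Z y') by apply: subset_closure.
have e1 : 0 < Num.min (e / 8) 1 by rewrite lt_min e8 ltr01.
have [d1 d10 dH] := approximating_family qc e1 Gy'.
(* [tau c] bounds [F tau x' - x'] in [q]: that vector is [tau Z y'] up to [tau], the minimum in [e1]
   capping the error. *)
pose c := q (Z y') + 1.
have c0 : 0 < c by rewrite ltr_wpDl // seminorm_ge0 //; exact: qc.1.
have ec0 : 0 < e / (2 * c) by rewrite divr_gt0 // mulr_gt0.
exists (Num.min d1 (e / (2 * c))); first by rewrite lt_min d10.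
move=> tau i j; rewrite lt_min => /andP[tau0 /andP[td1 tdc]].
wlog: i j / (j <= i)%N => [H iS jS ij|].
  have [ji|/ltnW ji] := leqP j i; first exact: H.
  rewrite -(seminormN _ (pX.1 a)) opprB; apply: H => //.
  by rewrite distrC.
move=> /subnKC <-; set m := (i - j)%N => iS jS.
rewrite natrD mulrDl addrAC subrr add0r ger0_norm ?mulr_ge0 // ?(ltW tau0) //.
rewrite le_min => /andP[_ mtau].
have [|x' x'y' Fx'] := dH tau; first by rewrite tau0.
have := @seminorm_iter_increment _ _ _ (p a) (F tau) x' 0 c tau j m (pX.1 a).
rewrite !scaler0 subr0 => H.
have {H}inc : p a (iter (j + m) (F tau) x' - iter j (F tau) x') <= e / 2.
  apply: le_trans (H _) _; last by rewrite -ler_pdivlMr // -mulrA -invfM.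
  move=> n nm; rewrite subr0; apply: le_trans (qS _ _ _ _ _) _ => //.
    apply: le_trans iS; rewrite ler_pM2r // ler_nat leq_add2l ltnW //.
  have [f [fD fN fZ fq <-]] := norming_functional (F tau x' - x') qc.1.
  have /andP[_] := fq _ _ Fx'; have /andP[_] := fq _ _ (lexx (q (Z y'))).
  rewrite !(fD, fN, fZ) -(ler_pM2l tau0) => h1 h2.
  have : tau * Num.min (e / 8) 1 <= tau * 1 by rewrite ler_pM2l // ge_min lexx orbT.
  by rewrite /c mulrDr; lra.
have xy : q (x' - y) <= e / 4.
  have [f [fD fN fZ fq <-]] := norming_functional (x' - y) qc.1.
  have /andP[_] := fq _ _ x'y'; have /andP[_] := fq _ _ (ltW yy').
  rewrite !(fD, fN); have : Num.min (e / 8) 1 <= e / 8 by rewrite ge_min lexx.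
  lra.
have h1 := le_trans (qS _ _ tau0 iS (x' - y)) xy.
have h2 := le_trans (qS _ _ tau0 jS (x' - y)) xy.
rewrite !iter_linearB in h1 h2.
have [f [fD fN fZ fq <-]] := norming_functional
  (iter (j + m) (F tau) y - iter j (F tau) y) (pX.1 a).
have /andP[+ _] := fq _ _ h1; have /andP[_] := fq _ _ h2.
have /andP[_] := fq _ _ inc; rewrite !(fD, fN); lra.
Qed.

(** In the telescoping sum for [x'] each term is nearly [tau F^(i+n) y], and slow variation replaces
    [F^(i+n) y] by [F^j y]. Returning from [x'] to [x] costs only [eta], which can be made small
    while [m tau] stays fixed because [d] does not depend on [eta]. *)
Lemma orbit_increment a (S e : R) y : 0 <= S -> 0 < e ->
  exists2 d : R, 0 < d & forall x, Gamma (x, y) -> forall eta, 0 < eta ->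
    exists2 d' : R, 0 < d' & forall tau i j m, 0 < tau < d' ->
      (i + m)%:R * tau <= S -> m%:R * tau <= d -> (i <= j <= i + m)%N ->
      p a (iter (i + m) (F tau) x - iter i (F tau) x
           - of_real k (m%:R * tau) *: iter j (F tau) y)
        <= m%:R * tau * e + eta.
Proof.
move=> S0 e0; have [q [qc qS]] := seminorm_stability a S0.
have e2 : 0 < e / 2 by lra.
have [d d0 dH] := orbit_slow_variation a y S0 e2.
exists d => // x Gxy eta eta0.
have e1 : 0 < Num.min (e / 2) (eta / 2) by rewrite lt_min e2; lra.
have [d1 d10 d1H] := approximating_family qc e1 Gxy.
exists (Num.min d d1); first by rewrite lt_min d0.
move=> tau i j m; rewrite lt_min => /andP[tau0 /andP[td td1]] imS md /andP[ij jim].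
have [|x' x'x Fx'] := d1H tau; first by rewrite tau0.
set w := iter j (F tau) y.
have inc : p a (iter (i + m) (F tau) x' - iter i (F tau) x'
           - of_real k (m%:R * tau) *: w) <= m%:R * tau * e.
  apply: seminorm_iter_increment; first exact: pX.1.
  move=> n nm.
  have leS r : (r <= i + m)%N -> r%:R * tau <= S.
    by move=> rim; apply: le_trans imS; rewrite ler_pM2r // ler_nat.
  have inS : (i + n)%:R * tau <= S by apply: leS; rewrite leq_add2l ltnW.
  have := qS _ _ tau0 inS (F tau x' - x' - of_real k tau *: y).
  have sv : p a (iter (i + n) (F tau) y - w) <= e / 2.
    apply: dH => //; [by rewrite tau0|exact: leS|].
    rewrite -mulrBl normrM (gtr0_norm tau0); apply: le_trans md.
    rewrite ler_pM2r // ler_norml; move: ij jim nm.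
    rewrite -!(ler_nat R) !natrD -natr1.
    have : 0 <= (n%:R : R) by []. move=> *; apply/andP; split; lra.
  move=> /le_trans/(_ Fx'); rewrite iter_linearB iter_linearZ => h.
  set u := iter (i + n) (F tau) (F tau x' - x') in h *.
  have [f [fD fN fZ fq <-]] := norming_functional
    (u - of_real k tau *: w) (pX.1 a).
  have /andP[_] := fq _ _ h; have /andP[_] := fq _ _ sv.
  rewrite !(fD, fN, fZ) -(ler_pM2l tau0) => h1 h2.
  have : tau * Num.min (e / 2) (eta / 2) <= tau * (e / 2).
    by rewrite ler_pM2l // ge_min lexx.
  lra.
have iS : i%:R * tau <= S.
  by apply: le_trans imS; rewrite ler_pM2r // ler_nat leq_addr.
have h1 := le_trans (qS _ _ tau0 imS (x' - x)) x'x.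
have h2 := le_trans (qS _ _ tau0 iS (x' - x)) x'x.
rewrite !iter_linearB in h1 h2.
set v := _ - _ - _ *: w.
have [f [fD fN fZ fq <-]] := norming_functional v (pX.1 a).
have /andP[+ _] := fq _ _ h1; have /andP[_] := fq _ _ h2.
have /andP[_] := fq _ _ inc; rewrite !(fD, fN, fZ).
have : Num.min (e / 2) (eta / 2) <= eta / 2 by rewrite ge_min lexx orbT.
lra.
Qed.

(** * Rounding times to multiples of the step *)

Lemma truncn_div_itv (s tau : R) : 0 <= s -> 0 < tau ->
  (Num.truncn (s / tau))%:R * tau <= s < (Num.truncn (s / tau))%:R * tau + tau.
Proof.
move=> s0 tau0; have /truncn_itv/andP[h1 h2] : 0 <= s / tau.
  by rewrite divr_ge0 // ltW.
rewrite -ler_pdivlMr // h1 /=.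
by move: h2; rewrite ltr_pdivrMr // -natr1 mulrDl mul1r.
Qed.

Lemma truncn_div_sub (b c tau : R) : 0 <= b -> b <= c -> 0 < tau ->
  exists i m, [/\ Num.truncn (b / tau) = i, Num.truncn (c / tau) = (i + m)%N,
    (i + m)%:R * tau <= c & `|m%:R * tau - (c - b)| <= tau].
Proof.
move=> b0 bc tau0; exists (Num.truncn (b / tau)).
exists (Num.truncn (c / tau) - Num.truncn (b / tau))%N.
have ij : (Num.truncn (b / tau) <= Num.truncn (c / tau))%N.
  by apply: le_truncn; rewrite ler_pM2r ?invr_gt0.
have /andP[h1 h2] := truncn_div_itv b0 tau0.
have /andP[h3 h4] := truncn_div_itv (le_trans b0 bc) tau0.
rewrite subnKC // natrB //; split=> //.
rewrite mulrBl ler_norml; apply/andP; split; lra.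
Qed.

(** Beyond the three estimated increments, [u - v] consists of [(s - b) (w' - w)] and the rounding
    error [(mu - (c - b)) w]. In its application [u] and [v] are the transported [f c] and [f b],
    while [u0] and [v0] come from [f s] with the same numbers of steps. *)
Lemma straddle_estimate (r : X -> R) u u0 v v0 w w' (e N eta tau mu b s c : R) :
  seminorm r -> b <= s -> s <= c -> 0 <= e -> `|mu - (c - b)| <= tau ->
  r (u - u0 - of_real k (c - s) *: w) <= e * (c - s) ->
  r (v - v0 - of_real k (b - s) *: w') <= e * (s - b) ->
  r (v0 - u0 - of_real k mu *: w) <= mu * e + eta ->
  r (w' - w) <= e -> r w <= N ->
  r (u - v) <= 3 * e * (c - b) + tau * (e + N) + eta.
Proof.
move=> rs bs sc e0 mutau h1 h2 h3 h4 h5.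
have h6 : r (of_real k (s - b) *: (w' - w)) <= (s - b) * e.
  by rewrite seminormZ // ger0_norm ?subr_ge0 // ler_wpM2l // subr_ge0.
have h7 : r (of_real k (mu - (c - b)) *: w) <= tau * N.
  by rewrite seminormZ // ler_pM // ?seminorm_ge0.
have h8 : (mu - (c - b)) * e <= tau * e.
  by rewrite ler_wpM2r //; move: mutau; rewrite ler_norml => /andP[].
have h9 : 0 <= e * (c - s) by rewrite mulr_ge0 ?subr_ge0.
have [g [gD gN gZ gq <-]] := norming_functional (u - v) rs.
have /andP[_] := gq _ _ h1; have /andP[+ _] := gq _ _ h2.
have /andP[+ _] := gq _ _ h3; have /andP[_] := gq _ _ h6.
have /andP[+ _] := gq _ _ h7; rewrite !(gD, gN, gZ).
move: h8 h9; clear; lra.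
Qed.

(* [F^(i+m) h - F^i h] and [F^m x - x] are about [m tau F^i g] and [m tau y], and
   differ by [F^m (F^i h - x) - (F^i h - x)]; take [m tau] small but fixed. *)
Lemma orbit_generator_limit a (S e : R) h g x y : 0 <= S -> 0 < e ->
  Gamma (h, g) -> Gamma (x, y) ->
  exists q (c d : R), [/\ continuous_seminorm q, 0 < c, 0 < d &
    forall tau i, 0 < tau < d -> i%:R * tau <= S ->
      q (iter i (F tau) h - x) <= c -> p a (iter i (F tau) g - y) <= e].
Proof.
move=> S0 e0 Ghg Gxy; have S10 : 0 <= S + 1 by rewrite addr_ge0.
have e8 : 0 < e / 8 by lra.
have [q [qc qS]] := seminorm_stability a S10.
have [d1 d10 /(_ _ Ghg) H1] := orbit_increment a g S10 e8.
have [d2 d20 /(_ _ Gxy) H2] := orbit_increment a y S10 e8.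
pose D := Num.min (Num.min d1 d2) 1.
have D0 : 0 < D by rewrite !lt_min d10 d20 ltr01.
(* Later [tau < D / 2] forces [m tau > D / 2], so four errors of [e D / 16] cost at most half of
   [m tau e]; the two slope errors cost a quarter. *)
have c0 : 0 < e * D / 16 by rewrite divr_gt0 // mulr_gt0.
have {H1} [d1' d1'0 H1] := H1 _ c0; have {H2} [d2' d2'0 H2] := H2 _ c0.
exists q, (e * D / 16), (Num.min (Num.min d1' d2') (D / 2)).
split=> //; first by rewrite !lt_min d1'0 d2'0 divr_gt0.
move=> tau i; rewrite !lt_min => /andP[tau0 /andP[/andP[t1 t2] tD]] iS hx.
pose m := Num.truncn (D / tau).
have /andP[mD Dm] : m%:R * tau <= D < m%:R * tau + tau.
  by apply: truncn_div_itv => //; rewrite ltW.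
have : [&& m%:R * tau <= d1, m%:R * tau <= d2 & m%:R * tau <= 1].
  by move: mD; rewrite /D !le_min => /andP[/andP[-> ->] ->].
move=> /and3P[md1 md2 m1].
have imS : (i + m)%:R * tau <= S + 1 by rewrite natrD mulrDl lerD.
have mS : (0 + m)%:R * tau <= S + 1 by rewrite add0n; lra.
have {H1} h1 : p a (iter (i + m) (F tau) h - iter i (F tau) h
    - of_real k (m%:R * tau) *: iter i (F tau) g)
    <= m%:R * tau * (e / 8) + e * D / 16.
  by apply: H1; rewrite ?tau0 // leqnn leq_addr.
have {H2} h2 := H2 tau 0%N 0%N m _ mS md2 isT; rewrite tau0 t2 add0n in h2.
have {}h2 := h2 isT.
have mS' : m%:R * tau <= S + 1 by lra.
have OS : 0%:R * tau <= S + 1 by rewrite mul0r.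
have h3 := le_trans (qS _ _ tau0 mS' (iter i (F tau) h - x)) hx.
have h4 := le_trans (qS _ _ tau0 OS (iter i (F tau) h - x)) hx.
rewrite iter_linearB -iterD (addnC m) in h3; rewrite /= in h2 h4.
have mtau0 : 0 < m%:R * tau by lra.
rewrite -(ler_pM2l mtau0).
have [f [fD fN fZ fq <-]] := norming_functional
  (iter i (F tau) g - y) (pX.1 a).
have /andP[+ _] := fq _ _ h1; have /andP[_] := fq _ _ h2.
have /andP[+ _] := fq _ _ h4; have /andP[_] := fq _ _ h3.
rewrite !(fD, fN, fZ).
have : e * D <= 2 * (e * (m%:R * tau)) by rewrite mulrCA ler_pM2l //; lra.
lra.
Qed.

(** At [i = 0] the orbit of [x] is [x] itself, so [orbit_generator_limit] compares [y] with [y']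
    directly. *)
Lemma op_closure_single_valued : hausdorff_space X -> forall x y y',
  Gamma (x, y) -> Gamma (x, y') -> y = y'.
Proof.
move=> hX x y y' Gy Gy'; apply: (seminorm_eq pX hX) => a e e0.
have e2 : 0 < e / 2 by lra.
have [q [c [d [qc c0 d0 H]]]] := orbit_generator_limit a ler01 e2 Gy Gy'.
have := H (d / 2) 0%N; rewrite mul0r /= subrr (seminorm0 qc.1).
have -> : 0 < d / 2 < d by apply/andP; split; lra.
by move=> /(_ isT ler01 (ltW c0)); lra.
Qed.

(** * Convergence of the orbits along a solution *)

Section Convergence.
Variables (f f' : R -> X) (T : R) (a : Omega).
Hypothesis T0 : 0 <= T.
Hypothesis fG : forall s, 0 <= s <= T -> Gamma (f s, f' s).
Hypothesis fderiv : forall q (e s : R), continuous_seminorm q -> 0 < e ->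
  0 <= s <= T -> exists2 d : R, 0 < d & forall c, 0 <= c <= T ->
    `|c - s| < d ->
    q (f c - f s - of_real k (c - s) *: f' s) <= e * `|c - s|.

(** Joins the orbit of [f 0], at [s = 0], to [f T], at [s = T]; the convergence sought says that its
    total increment vanishes as [tau] tends to 0. *)
Let transport tau s := iter (Num.truncn ((T - s) / tau)) (F tau) (f s).

(** Says that the limit superior of the increment as [tau] tends to 0 is at most [kappa]. The
    threshold on [tau] may depend on the interval. *)
Let drift b c kappa := forall eta : R, 0 < eta -> exists2 d : R, 0 < d &
  forall tau, 0 < tau < d -> p a (transport tau c - transport tau b) <= kappa + eta.

Let drift_add b c c' kappa kappa' :
  drift b c kappa -> drift c c' kappa' -> drift b c' (kappa + kappa').
Proof.
move=> H H' eta eta0; have eta2 : 0 < eta / 2 by lra.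
have {H} [d d0 H] := H _ eta2; have {H'} [d' d'0 H'] := H' _ eta2.
exists (Num.min d d'); first by rewrite lt_min d0.
move=> tau; rewrite lt_min => /andP[tau0 /andP[td td']].
have {}H := H tau; rewrite tau0 td in H; have {}H := H isT.
have {}H' := H' tau; rewrite tau0 td' in H'; have {}H' := H' isT.
have [g [gD gN gZ gq <-]] := norming_functional
  (transport tau c' - transport tau b) (pX.1 a).
have /andP[_] := gq _ _ H; have /andP[_] := gq _ _ H'.
rewrite !(gD, gN); lra.
Qed.

(** Differentiability at [s] compares [f] only with [f s], so the interval has to contain [s]. *)
Let drift_straddle (e s : R) : 0 < e -> 0 <= s <= T ->
  exists2 d : R, 0 < d & forall b c, 0 <= b <= s -> s <= c <= T ->
    s - d < b -> c < s + d -> drift b c (e * (c - b)).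
Proof.
move=> e0 sT; have e3 : 0 < e / 3 by lra.
have [q [qc qS]] := seminorm_stability a T0.
have [d1 d10 /(_ _ (fG sT)) H1] := orbit_increment a (f' s) T0 e3.
have [d2 d20 H2] := orbit_slow_variation a (f' s) T0 e3.
have [d3 d30 H3] := fderiv qc e3 sT.
pose D := Num.min (Num.min d1 d2) d3.
have D0 : 0 < D by rewrite !lt_min d10 d20.
(* With this radius [c - b <= D / 2], and [tau < D / 2] then gives [m tau <= D]. *)
exists (D / 4); first by rewrite divr_gt0.
move=> b c /andP[b0 bs] /andP[sc cT] sb cs eta eta0.
have [bc cb] : b <= c /\ c - b <= D / 2 by split; lra.
have [{}sb {}cs] : s - b < D /\ c - s < D by split; lra.
have eta2 : 0 < eta / 2 by lra.
have {H1} [d4 d40 H1] := H1 _ eta2.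
pose N := q (f' s).
have M0 : 0 < e / 3 + N by rewrite ltr_wpDr // (seminorm_ge0 _ qc.1).
(* The last bound makes the rounding cost [tau (e / 3 + N)] at most [eta / 2]. *)
exists (Num.min (Num.min d4 (D / 2)) (eta / 2 / (e / 3 + N))).
  by rewrite !lt_min d40 !divr_gt0.
move=> tau; rewrite !lt_min => /andP[tau0 /andP[/andP[t4 tD] teta]].
have cT0 : 0 <= T - c by rewrite subr_ge0.
have cTb : T - c <= T - b by rewrite lerD2l lerN2.
have [i [m [Ei Ej imS mtau]]] := truncn_div_sub cT0 cTb tau0.
have {}imS : (i + m)%:R * tau <= T by apply: le_trans imS _; rewrite gerBl.
have bcE : T - b - (T - c) = c - b by ring.
rewrite bcE in mtau.
rewrite /transport Ei Ej; clear Ei Ej.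
have iS : i%:R * tau <= T.
  by apply: le_trans imS; rewrite ler_pM2r // ler_nat leq_addr.
have mD : m%:R * tau <= D.
  by move: mtau; rewrite ler_norml => /andP[_]; lra.
move: mD; rewrite /D !le_min => /andP[/andP[md1 md2] _].
move: sb cs tD; rewrite /D !lt_min => /andP[_ sb] /andP[_ cs] tD.
have t2 : tau < d2.
  by apply: lt_trans tD _; rewrite ltr_pdivrMr // !gt_min; lra.
have h1 := H1 tau i i m _ imS md1; rewrite tau0 t4 leqnn leq_addr in h1.
have {H1} {}h1 := h1 isT isT.
have h2 : p a (iter (i + m) (F tau) (f' s) - iter i (F tau) (f' s)) <= e / 3.
  apply: H2; rewrite ?tau0 // natrD mulrDl addrAC subrr add0r.
  by rewrite ger0_norm // mulr_ge0 // ltW.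
have h3 : q (f c - f s - of_real k (c - s) *: f' s) <= e / 3 * (c - s).
  rewrite -[X in _ <= _ * X]ger0_norm ?subr_ge0 //; apply: H3.
    by rewrite cT (le_trans b0).
  by rewrite ger0_norm ?subr_ge0.
have h4 : q (f b - f s - of_real k (b - s) *: f' s) <= e / 3 * (s - b).
  rewrite -[X in _ <= _ * X]ger0_norm ?subr_ge0 // distrC; apply: H3.
    by rewrite b0 (le_trans bc).
  by rewrite distrC ger0_norm ?subr_ge0.
have {}h3 := le_trans (qS _ _ tau0 iS _) h3.
have {}h4 := le_trans (qS _ _ tau0 imS _) h4.
rewrite !iter_linearB iter_linearZ in h3; rewrite !iter_linearB iter_linearZ in h4.
have h5 : p a (iter i (F tau) (f' s)) <= N by exact: qS.
have h6 := straddle_estimate (pX.1 a) bs sc (ltW e3) mtau h3 h4 h1 h2 h5.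
apply: le_trans h6 _.
have -> : 3 * (e / 3) * (c - b) = e * (c - b) by field.
rewrite -addrA lerD2l [leRHS](splitr eta) lerD2r.
by rewrite -ler_pdivlMr // ltW.
Qed.

(** Let [A] hold the times up to which the drift stays below [e1 c]. The estimate around [sup A]
    leads from some [b] in [A] to a time of [A] beyond [sup A], unless [T] has been reached. *)
Lemma chernoff_convergence (e : R) : 0 < e -> exists2 d : R, 0 < d &
  forall tau, 0 < tau < d ->
    p a (f T - iter (Num.truncn (T / tau)) (F tau) (f 0)) <= e.
Proof.
(* This gives [e1 T <= e / 2], with [T + 1] in the denominator in case [T = 0]. *)
move=> e0; pose e1 := e / (2 * (T + 1)).
have T1 : 0 < T + 1 by rewrite ltr_wpDl.
have e10 : 0 < e1 by rewrite divr_gt0 // mulr_gt0.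
pose A := [set c | 0 <= c <= T /\ drift 0 c (e1 * c)].
have A0 : A 0.
  split=> [|eta eta0]; first by rewrite lexx.
  exists 1 => // tau _; rewrite subrr (seminorm0 (pX.1 a)) mulr0 add0r ltW //.
have supA : has_sup A by split; [exists 0|exists T => c [/andP[]]].
have sT : 0 <= sup A <= T.
  apply/andP; split; first exact: sup_upper_bound supA _ A0.
  by apply: ge_sup; [exists 0|move=> c [/andP[]]].
have [d d0 H] := drift_straddle e10 sT.
have [b [/andP[b0 bT] Ab] sb] := sup_adherent d0 supA.
have bs : b <= sup A by apply: sup_upper_bound => //; split=> //; rewrite b0.
have cA : A (Num.min T (sup A + d / 2)).
  move: sT => /andP[s0 sT].
  have c0 : 0 <= Num.min T (sup A + d / 2) by rewrite le_min T0 addr_ge0 // ltW ?divr_gt0.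
  have cT : Num.min T (sup A + d / 2) <= T by rewrite ge_min lexx.
  split; first by rewrite c0.
  rewrite (_ : e1 * _ = e1 * b + e1 * (Num.min T (sup A + d / 2) - b)); last by ring.
  apply: drift_add Ab _; apply: H => //; first by rewrite b0.
    by rewrite cT andbT le_min sT lerDl ltW ?divr_gt0.
  by rewrite gt_min; apply/orP; right; lra.
have := sup_upper_bound supA cA; rewrite ge_min; case/orP => [Ts|]; last by lra.
have sTE : Num.min T (sup A + d / 2) = T by apply/min_idPl; lra.
have e2 : 0 < e / 2 by lra.
rewrite sTE in cA; have [d' d'0 {}H] := cA.2 _ e2.
exists d' => // tau taud; have := H _ taud.
rewrite /transport subrr mul0r truncn0 subr0 /= => /le_trans; apply.
rewrite /e1; have : e / (2 * (T + 1)) * T <= e / 2.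
  by rewrite invfM mulrA -mulrA ler_piMr ?ltW // ltr_pdivrMl // mulr1 ltrDl.
lra.
Qed.

End Convergence.

End ChernoffEstimates.

(** * Convergence of the Chernoff sequence *)

Section Subsequences.

Lemma increasing_index_ge phi n : increasing_index phi -> (n <= phi n)%N.
Proof.
move=> phii; elim: n => // n /leq_ltn_trans; apply; exact: phii.
Qed.

Lemma increasing_index_cvg phi : increasing_index phi -> phi @ \oo --> \oo.
Proof.
move=> phii A [N _ NA]; exists N => // n /= Nn; apply: NA => /=.
by apply: leq_trans Nn _; exact: increasing_index_ge.
Qed.

Lemma increasing_index_comp phi psi : increasing_index phi ->
  increasing_index psi -> increasing_index (phi \o psi).
Proof. by move=> phii psii m n mn; apply/phii/psii. Qed.

(** [C i phi] reads: property number [i] holds along [phi]. It must survive reparametrisation by any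
    [chi] tending to infinity, up to finitely many indices, since the diagonal lies only eventually
    in a given stage. *)
Lemma diagonal_subsequence (C : nat -> (nat -> nat) -> Prop) :
  (forall i phi, increasing_index phi ->
    exists psi, increasing_index psi /\ C i (phi \o psi)) ->
  (forall i phi phi' chi N, C i phi -> chi @ \oo --> \oo ->
    (forall n, (N <= n)%N -> phi' n = phi (chi n)) -> C i phi') ->
  exists phi, increasing_index phi /\ forall i, C i phi.
Proof.
move=> Cex Csub.
have [step stepP] : exists step : nat * (nat -> nat) -> nat -> nat,
    forall v, increasing_index v.2 ->
      increasing_index (step v) /\ C v.1 (v.2 \o step v).
  suff /choice[step H] : forall v : nat * (nat -> nat), exists psi : nat -> nat,
      increasing_index v.2 -> increasing_index psi /\ C v.1 (v.2 \o psi).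
    by exists step.
  move=> [i phi] /=.
  have [/(Cex i)[psi H]|n] := pselect (increasing_index phi).
    by exists psi.
  by exists id => /n.
(* Nested extractions: [th n.+1] refines [th n] and satisfies [C n]. *)
pose th := fix th n := if n is n'.+1 then th n' \o step (n', th n') else id.
have thi n : increasing_index (th n).
  elim: n => [|n IH] //; apply: increasing_index_comp => //.
  by case: (stepP (n, th n) IH).
have thC n : C n (th n.+1) by case: (stepP (n, th n) (thi n)).
have thsub i m : exists chi, increasing_index chi /\ th (i + m)%N = th i \o chi.
  elim: m => [|m [chi [chii E]]]; first by exists id; split=> //; rewrite addn0.
  have [si _] := stepP ((i + m)%N, th (i + m)%N) (thi _).
  exists (chi \o step ((i + m)%N, th (i + m)%N)).
  by split; [exact: increasing_index_comp|rewrite addnS /= E].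
exists (fun n => th n n); split.
  have H : {homo (fun n => th n n) : m n / (m < n)%N}.
    apply: homo_ltn => [? ? ?|n]; first exact: ltn_trans.
    apply: (thi n n); apply: increasing_index_ge.
    by case: (stepP (n, th n) (thi n)).
  by move=> m n; exact: H.
(* For [n > i] the diagonal term is [th i.+1 m] with [m >= n]; for [n <= i] the value [chi n = n] is
   a filler. *)
move=> i; have /choice[chi chiP] : forall n, exists m,
    (n <= m)%N /\ ((i.+1 <= n)%N -> th n n = th i.+1 m).
  move=> n; have [ni|] := leqP i.+1 n; last by exists n; split.
  have [chi [chii E]] := thsub i.+1 (n - i.+1)%N.
  exists (chi n); rewrite -[in th n](subnKC ni) E; split=> //.
  exact: increasing_index_ge.
apply: (Csub i _ _ chi i.+1 (thC i)); last by move=> n; case: (chiP n).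
move=> A [N _ NA]; exists N => // n /= Nn; apply: NA => /=.
by apply: leq_trans Nn _; case: (chiP n).
Qed.

End Subsequences.

(** * Orbits with steps [t / n] *)

Section ChernoffSequence.
Variables (R : realType) (k : scalar_kind) (X : tvsType (scalars R k)).
Hypothesis hausX : hausdorff_space X.
Variables (Omega : Type) (p : Omega -> X -> R).
Hypothesis pX : generating_seminorms p.
Variable Z : partial_operator X.
Hypotheses (linZ : linear_operator Z) (denseZ : dense (op_dom Z)).
Variables (t : R) (F : R -> {linear X -> X}).
Hypotheses (t0 : 0 < t) (FX : chernoff_bounded p F).
Hypothesis ZF : forall g, op_dom Z g -> mv_effective_derivative F g (Z g).

Notation Gamma := (closure (op_graph Z)).
Notation mesh n := (t / n.+1%:R).
Notation orbit := (chernoff_sequence F t).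

Lemma mesh_gt0 n : 0 < mesh n.
Proof. by rewrite divr_gt0. Qed.

Lemma mesh_lt d : 0 < d -> \forall n \near \oo, mesh n < d.
Proof.
move=> d0; exists (Num.truncn (t / d)) => // n /= nN.
rewrite ltr_pdivrMr // mulrC -ltr_pdivrMr //.
by apply: lt_le_trans (truncnS_gt _) _; rewrite ler_nat.
Qed.

Lemma orbitE s x n :
  orbit s x n = iter (Num.truncn (s / mesh n)) (F (mesh n)) x.
Proof. by rewrite /chernoff_sequence invf_div mulrCA mulrA. Qed.

(** Slow variation at half its radius; the other half absorbs the rounding of the times once the
    step is below [d / 2]. *)
Lemma orbit_equicontinuous a (S e : R) x : 0 <= S -> 0 < e ->
  exists2 d : R, 0 < d & forall s s', 0 <= s <= S -> 0 <= s' <= S ->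
    `|s' - s| <= d -> \forall n \near \oo, p a (orbit s' x n - orbit s x n) <= e.
Proof.
move=> S0 e0.
have [d d0 H] := orbit_slow_variation pX denseZ FX ZF a x S0 e0.
exists (d / 2); first by rewrite divr_gt0.
move=> s s'; wlog : s s' / s <= s' => [W sS s'S|ss'].
  have [ss'|/ltW ss'] := leP s s'; first exact: W.
  move=> sd; have := W _ _ ss' s'S sS; rewrite distrC => /(_ sd).
  by apply: filterS => n; rewrite -(seminormN (_ - _) (pX.1 a)) opprB.
move=> /andP[s0 _] /andP[_ s'S]; rewrite ger0_norm ?subr_ge0 // => sd.
have d2 : 0 < d / 2 by lra.
apply: filterS (mesh_lt d2) => n; rewrite !orbitE.
move: (mesh n) (mesh_gt0 n) => tau tau0 nd.
have [i [m [-> -> imS mtau]]] := truncn_div_sub s0 ss' tau0.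
have imS' := le_trans imS s'S.
apply: H => //; first by rewrite tau0 /=; lra.
  by apply: le_trans imS'; rewrite ler_pM2r // ler_nat leq_addr.
rewrite natrD mulrDl addrAC subrr add0r ger0_norm; last first.
  by rewrite mulr_ge0 // ltW.
by move: mtau; rewrite ler_norml => /andP[_]; lra.
Qed.

(** Trades the rounded length [mu] for the exact length [c] at the cost [tau (e + N)]. *)
Lemma increment_recenter (r : X -> R) v w (e N eta tau mu c : R) :
  seminorm r -> 0 <= e -> `|mu - c| <= tau ->
  r (v - of_real k mu *: w) <= mu * e + eta -> r w <= N ->
  r (v - of_real k c *: w) <= c * e + tau * (e + N) + eta.
Proof.
move=> rs e0 muc h1 h2.
have h3 : r (of_real k (mu - c) *: w) <= tau * N.
  by rewrite seminormZ // ler_pM // ?seminorm_ge0.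
have h4 : (mu - c) * e <= tau * e.
  by rewrite ler_wpM2r //; move: muc; rewrite ler_norml => /andP[].
have [g [gD gN gZ gq <-]] := norming_functional (v - of_real k c *: w) rs.
have /andP[_] := gq _ _ h1; have /andP[_] := gq _ _ h3.
rewrite !(gD, gN, gZ); lra.
Qed.

(** [orbit_increment] allows any [j] between the two ends, so [s] may be either end of the interval;
    this makes the derivative of the limit two-sided. *)
Lemma orbit_derivative a (S e : R) h g : 0 <= S -> 0 < e -> Gamma (h, g) ->
  exists2 d : R, 0 < d & forall s s', 0 <= s <= S -> 0 <= s' <= S ->
    `|s' - s| <= d -> forall eta, 0 < eta -> \forall n \near \oo,
      p a (orbit s' h n - orbit s h n - of_real k (s' - s) *: orbit s g n)
        <= `|s' - s| * e + eta.
Proof.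
move=> S0 e0 Ghg.
have [q [qc qS]] := seminorm_stability pX FX a S0.
have [d d0 /(_ _ Ghg) H] := orbit_increment pX denseZ FX ZF a g S0 e0.
exists (d / 2); first by rewrite divr_gt0.
move=> s s' sS s'S sd eta eta0.
have eta2 : 0 < eta / 2 by lra.
have {H} [d' d'0 H] := H _ eta2.
pose N := q g; have M0 : 0 < e + N by rewrite ltr_wpDr // (seminorm_ge0 _ qc.1).
have D0 : 0 < Num.min d' (Num.min (d / 2) (eta / 2 / (e + N))).
  by rewrite !lt_min d'0 !divr_gt0.
apply: filterS (mesh_lt D0) => n.
rewrite !lt_min => /and3P[nd' nd nM]; rewrite !orbitE.
have tau0 := mesh_gt0 n; move: (mesh n) tau0 nd' nd nM => tau tau0 nd' nd nM.
have fin x : p a x <= `|s' - s| * e + tau * (e + N) + eta / 2 ->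
    p a x <= `|s' - s| * e + eta.
  move=> /le_trans; apply; rewrite -addrA lerD2l [leRHS](splitr eta) lerD2r.
  by rewrite -ler_pdivlMr // ltW.
(* [b <= c] are the two times in increasing order, [j] is the index of [s]. *)
have key b c j : 0 <= b <= S -> 0 <= c <= S -> b <= c -> `|c - b| <= d / 2 ->
    (Num.truncn (b / tau) <= j <= Num.truncn (c / tau))%N ->
    p a (iter (Num.truncn (c / tau)) (F tau) h
      - iter (Num.truncn (b / tau)) (F tau) h
      - of_real k (c - b) *: iter j (F tau) g)
    <= (c - b) * e + tau * (e + N) + eta / 2.
  move=> /andP[b0 _] /andP[_ cS] bc; rewrite ger0_norm ?subr_ge0 // => bcd.
  have [i [m [-> -> imS mtau]]] := truncn_div_sub b0 bc tau0 => /andP[ij jim].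
  have {}imS := le_trans imS cS.
  apply: (increment_recenter (pX.1 a) (ltW e0) mtau).
    apply: H; rewrite ?tau0 ?ij //.
    by move: mtau; rewrite ler_norml => /andP[_]; lra.
  by apply: qS => //; apply: le_trans imS; rewrite ler_pM2r // ler_nat.
apply: fin; have [ss'|/ltW ss'] := leP s s'.
  rewrite [X in X * e]ger0_norm ?subr_ge0 //; apply: key => //.
  by rewrite leqnn le_truncn // ler_pM2r ?invr_gt0.
rewrite distrC [X in X * e]ger0_norm ?subr_ge0 //.
set u := iter _ _ h; set u' := iter _ _ h; set w := of_real _ _ *: _.
have -> : u - u' - w = - (u' - u - of_real k (s - s') *: iter (Num.truncn (s / tau)) (F tau) g).
  by rewrite /w -(opprB s s') of_realN scaleNr opprK !opprB addrC.
rewrite (seminormN _ (pX.1 a)); apply: key => //; first by rewrite distrC.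
by rewrite leqnn andbT le_truncn // ler_pM2r ?invr_gt0.
Qed.

Lemma orbit_generator_cvg s h g x y phi : 0 <= s -> increasing_index phi ->
  Gamma (h, g) -> Gamma (x, y) -> orbit s h \o phi @ \oo --> x ->
  orbit s g \o phi @ \oo --> y.
Proof.
move=> s0 phii Ghg Gxy hx.
have FF : Filter (\oo : set_system nat) by exact: eventually_filter.
apply: (seminorm_cvg pX FF) => a e e0; have e2 : 0 < e / 2 by lra.
have [q [c [d [qc c0 d0 H]]]] :=
  orbit_generator_limit pX denseZ FX ZF a s0 e2 Ghg Gxy.
have n1 := continuous_seminorm_cvg FF qc hx c0.
have n2 := increasing_index_cvg phii (mesh_lt d0).
apply: filterS (filterI n1 n2) => n [/= /ltW qn nd]; move: qn.
rewrite !orbitE => qn; apply: le_lt_trans (H _ _ _ _ qn) _; last by lra.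
  by rewrite mesh_gt0.
by have /andP[] := truncn_div_itv s0 (mesh_gt0 (phi n)).
Qed.

(** Diagonal extraction handles the rational times. At any time (a) supplies a limit point, and
    comparison with a nearby rational time shows that the orbit converges to it along all of
    [phi]. *)
Lemma orbit_subsequence h (l : R) :
  (forall s, 0 <= s < l -> subsequentially_compact (@strong_cvg R k X) (orbit s h)) ->
  exists phi, increasing_index phi /\ exists f : R -> X,
    forall s, 0 <= s < l -> orbit s h \o phi @ \oo --> f s.
Proof.
(* [r] enumerates the rationals, with default 0 at codes of none. *)
move=> ca; pose r i : R := if unpickle i is Some q then ratr q else 0.
pose C i phi := 0 <= r i < l -> exists x : X, orbit (r i) h \o phi @ \oo --> x.
have [||phi [phii phiC]] := @diagonal_subsequence C.
- move=> i phi phii; have [ri|ri] := pselect (0 <= r i < l); last by exists id; split=> // /ri.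
  by have [psi [psii [x xc]]] := ca _ ri phi phii; exists psi; split=> // _; exists x.
- move=> i phi phi' chi N Ci chioo E ri; have [x xc] := Ci ri; exists x.
  apply: (cvg_trans _ (cvg_comp _ _ chioo xc)).
  by apply: near_eq_cvg; exists N => // n /= nN; rewrite E.
exists phi; split=> //.
suff /choice[f fP] : forall s, exists x : X,
    0 <= s < l -> orbit s h \o phi @ \oo --> x by exists f.
move=> s; have [sl|/negP nsl] := boolP (0 <= s < l); last by exists 0.
have /andP[s0 sl'] := sl.
have [psi [psii [x xc]]] := ca _ sl phi phii; exists x => _.
have FF : Filter (\oo : set_system nat) by exact: eventually_filter.
apply: (seminorm_cvg pX FF) => a e e0; have e4 : 0 < e / 8 by lra.
have l0 : 0 <= l by rewrite ltW // (le_lt_trans s0).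
have [d d0 H] := orbit_equicontinuous a h l0 e4.
(* A rational time to the right of [s] is nonnegative; it is taken below [l] and within [d] of
   [s]. *)
have [|y] := @rat_in_itvoo R s (Num.min l (s + d)).
  by rewrite lt_min sl' ltrDl.
rewrite in_itv /= lt_min => /and3P[sy yl ysd].
have rE : r (pickle y) = ratr y by rewrite /r pickleK.
have yl' : 0 <= r (pickle y) < l by rewrite rE yl andbT (le_trans s0) // ltW.
have [z zc] := phiC _ yl'; rewrite rE in zc.
have near : \forall n \near \oo, p a (orbit s h n - orbit (ratr y) h n) <= e / 8.
  move: (ratr y) sy yl ysd => x' sx' x'l x'd; apply: H.
  - by rewrite (ltW x'l) (le_trans s0) // ltW.
  - by rewrite s0 ltW.
  - by rewrite distrC ger0_norm ?subr_ge0 ?lerBlDl // ltW.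
have pc := generating_continuous pX a.
have n1 := increasing_index_cvg phii near.
have n2 := continuous_seminorm_cvg FF pc zc e4.
have n3 := continuous_seminorm_cvg FF pc xc e4.
have n4 := increasing_index_cvg psii n1.
have n5 := increasing_index_cvg psii n2.
(* One index [m] along [psi] is fixed. From [x] to the orbit at time [s] and index [n] there are
   five links of size [e / 8], through index [m] at times [s] and [y], then [z], then index [n] at
   time [y]. *)
have {n3 n4 n5} [m [/= m3 [/= m4 m5]]] := filter_ex (filterI n3 (filterI n4 n5)).
apply: filterS (filterI n2 n1) => n [/= h2 h1].
have [g [gD gN gZ gq <-]] := norming_functional (orbit s h (phi n) - x) pc.1.
have /andP[_] := gq _ _ h1; have /andP[_] := gq _ _ (ltW h2).
have /andP[+ _] := gq _ _ (ltW m5); have /andP[+ _] := gq _ _ m4.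
have /andP[_] := gq _ _ (ltW m3).
rewrite !(gD, gN) /=; move: e0; clear; lra.
Qed.

Lemma op_closure_graph x : op_dom (op_closure Z) x -> Gamma (x, op_closure Z x).
Proof. by move=> Zx; exact: (@xgetPex _ 0 [set y | Gamma (x, y)] Zx). Qed.

Lemma op_closureE x y : Gamma (x, y) -> op_closure Z x = y.
Proof.
move=> Gxy; have Gx : Gamma (x, op_closure Z x).
  by apply: op_closure_graph; exists y.
exact: (op_closure_single_valued pX denseZ FX ZF hausX Gx Gxy).
Qed.

(** * From a solution to convergent orbits *)

Lemma local_solution_increment (A : partial_operator X) l h f q (e s : R) :
  local_solution A l h f -> continuous_seminorm q -> 0 < e -> 0 <= s < l ->
  exists2 d : R, 0 < d & forall c, 0 <= c < l -> `|c - s| < d ->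
    q (f c - f s - of_real k (c - s) *: A (f s)) <= e * `|c - s|.
Proof.
move=> [_ fs] qc e0 /fs [_ fder].
have FF : Filter (within [set e | 0 <= s + e < l] 0^') by exact: within_filter.
have [d /= d0 H] := continuous_seminorm_cvg FF qc fder e0.
exists d => // c cl cs.
have [->|cs0] := eqVneq c s.
  by rewrite !subrr of_real0 scale0r subr0 (seminorm0 qc.1) normr0 mulr0.
have z0 : c - s != 0 by rewrite subr_eq0.
have := H (c - s); rewrite /= sub0r normrN => /(_ cs z0).
have -> : s + (c - s) = c by rewrite addrC subrK.
move=> /(_ cl) /ltW; rewrite -(ler_pM2l (_ : 0 < `|c - s|)) ?normr_gt0 //.
rewrite -(seminormZ _ _ qc.1) scalerBr scalerA -of_realV -of_realM mulfV //.
by rewrite of_real1 scale1r [leRHS]mulrC.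
Qed.

(** Allows every small step [tau], so that it covers both the steps [t / n] and the steps [v / n] of
    the limit formula. *)
Lemma mesh_convergence l h f v a (e : R) :
  local_solution (op_closure Z) l h f -> 0 <= v < l -> 0 < e ->
  exists2 d : R, 0 < d & forall tau, 0 < tau < d ->
    p a (iter (Num.truncn (v / tau)) (F tau) h - f v) < e.
Proof.
move=> sol /andP[v0 vl] e0; have e2 : 0 < e / 2 by lra.
have lv s : 0 <= s <= v -> 0 <= s < l.
  by move=> /andP[-> sv]; rewrite (le_lt_trans sv).
have fG s : 0 <= s <= v -> Gamma (f s, op_closure Z (f s)).
  by move=> /lv sl; apply: op_closure_graph; case: (sol.2 _ sl).
have fd q (e' s : R) : continuous_seminorm q -> 0 < e' -> 0 <= s <= v ->
    exists2 d : R, 0 < d & forall c, 0 <= c <= v -> `|c - s| < d ->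
    q (f c - f s - of_real k (c - s) *: op_closure Z (f s)) <= e' * `|c - s|.
  move=> qc e'0 /lv sl; have [d d0 H] := local_solution_increment sol qc e'0 sl.
  by exists d => // c /lv; exact: H.
have [d d0 H] := chernoff_convergence pX denseZ FX ZF a v0 fG fd e2.
exists d => // tau /H; rewrite sol.1 -(seminormN _ (pX.1 a)) opprB; lra.
Qed.

Lemma orbit_cvg_solution l h f s :
  local_solution (op_closure Z) l h f -> 0 <= s < l -> orbit s h @ \oo --> f s.
Proof.
move=> sol sl; have FF : Filter (\oo : set_system nat) by exact: eventually_filter.
apply: (seminorm_cvg pX FF) => a e e0.
have [d d0 H] := mesh_convergence a sol sl e0.
by apply: filterS (mesh_lt d0) => n nd; rewrite orbitE H // mesh_gt0.
Qed.

Lemma graph0 : op_graph Z (0, 0).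
Proof.
case: linZ => Z0 Zlin; split=> //=; have [_] := Zlin 1 0 0 Z0 Z0.
by rewrite scale1r addr0 scale1r => /eqP; rewrite -subr_eq0 opprD addNKr oppr_eq0 => /eqP.
Qed.

Lemma graph_linear (a : scalars R k) v w :
  op_graph Z v -> op_graph Z w -> op_graph Z (a *: v + w).
Proof.
move=> [Zv vE] [Zw wE]; have [Zvw E] := linZ.2 a _ _ Zv Zw.
by split=> //=; rewrite E vE wE.
Qed.

(** Along a subsequence [fs] converges weakly to [x] and its images to some [y], and weak limits do
    not leave the closure of the graph, a closed subspace. *)
Lemma orbit_limit_domain s h phi x (fs : nat -> X) : increasing_index phi ->
  (forall n, op_dom (op_closure Z) (fs n)) ->
  weak_cvg (fun n => orbit s h n - fs n) 0 ->
  subsequentially_compact (@weak_cvg R k X) (fun n => op_closure Z (fs n)) ->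
  orbit s h \o phi @ \oo --> x -> exists y, Gamma (x, y).
Proof.
move=> phii fsd ufs sc ux; have [psi [psii [y yc]]] := sc _ phii; exists y.
apply: (weak_limit_closure pX graph0 graph_linear _ _ yc (u := fs \o phi \o psi)).
  by move=> n; exact: (op_closure_graph (fsd _)).
apply/weak_cvgP => b.
have /weak_cvgP/(_ b) h1 := strong_weak_cvg ux.
have /weak_cvgP/(_ b) h2 := ufs.
have H := cvgB (cvg_comp _ _ (increasing_index_cvg psii) h1)
  (cvg_comp _ _ (increasing_index_cvg (increasing_index_comp phii psii)) h2).
rewrite linear0 subr0 in H.
rewrite (_ : (fun n => sval b _) = fun n => sval b (orbit s h (phi (psi n)))
    - sval b (orbit s h (phi (psi n)) - fs (phi (psi n)))); first exact: H.
by apply/funext => n /=; rewrite linearB opprB addrC subrK.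
Qed.

(** [orbit_derivative] passes to the limit along [phi]: the orbit of [h] tends to [f], and that of
    its image [g] to the image of [f s]. *)
Lemma orbit_limit_solution h l phi (f : R -> X) : 0 < l ->
  op_dom (op_closure Z) h -> increasing_index phi ->
  (forall s, 0 <= s < l -> orbit s h \o phi @ \oo --> f s) ->
  (forall s, 0 <= s < l -> exists y, Gamma (f s, y)) ->
  local_solution (op_closure Z) l h f.
Proof.
move=> l0 /op_closure_graph Gh phii fc fG.
have FF : Filter (\oo : set_system nat) by exact: eventually_filter.
split.
  have l00 : (0 : R) <= 0 < l by rewrite lexx.
  apply: (cvg_unique hausX (fc 0 l00)).
  rewrite (_ : _ \o _ = fun=> h); first exact: cvg_cst.
  by apply/funext => n /=; rewrite orbitE mul0r truncn0.
move=> s sl; have [y Gy] := fG _ sl; have /andP[s0 sl'] := sl.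
rewrite (op_closureE Gy); split; first by exists y.
have gc := orbit_generator_cvg s0 phii Gh Gy (fc _ sl).
set g := op_closure Z h in Gh gc.
have FW : Filter (within [set e | 0 <= s + e < l] 0^') by exact: within_filter.
apply: (seminorm_cvg pX FW) => a e e0; have e2 : 0 < e / 2 by lra.
have [d d0 H] := orbit_derivative a (ltW l0) e2 Gh.
exists d => // z /=; rewrite sub0r normrN => zd z0 szl.
have pc := generating_continuous pX a.
have sS : 0 <= s <= l by rewrite s0 ltW.
have szS : 0 <= s + z <= l by case/andP: szl => -> /ltW.
have szz : s + z - s = z by rewrite addrC addKr.
have key : p a (f (s + z) - f s - of_real k z *: y) <= `|z| * (e / 2).
  apply/ler_addgt0Pr => eta eta0; have eta4 : 0 < eta / 4 by lra.
  (* Divided by [|z|] because this error is later multiplied by [z]. *)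
  have z1 : 0 < eta / 4 / `|z| by rewrite divr_gt0 // normr_gt0.
  have := H _ _ sS szS; rewrite szz => /(_ (ltW zd) _ eta4).
  move=> /(increasing_index_cvg phii) n1.
  have n2 := continuous_seminorm_cvg FF pc (fc _ szl) eta4.
  have n3 := continuous_seminorm_cvg FF pc (fc _ sl) eta4.
  have n4 := continuous_seminorm_cvg FF pc gc z1.
  have [n [/= h2 [h3 [h4 h1]]]] := filter_ex (filterI n2 (filterI n3 (filterI n4 n1))).
  have h5 : p a (of_real k z *: (orbit s g (phi n) - y)) <= eta / 4.
    rewrite (seminormZ _ _ pc.1) mulrC -ler_pdivlMr ?normr_gt0 //.
    by move: h4 => /= /ltW.
  rewrite /= in h1 h2 h3.
  have [b [bD bN bZ bq <-]] := norming_functional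
    (f (s + z) - f s - of_real k z *: y) pc.1.
  have /andP[_] := bq _ _ h1; have /andP[+ _] := bq _ _ (ltW h2).
  have /andP[_] := bq _ _ (ltW h3); have /andP[_] := bq _ _ h5.
  rewrite !(bD, bN, bZ); move: eta0; clear; lra.
have -> : (of_real k z)^-1 *: (f (s + z) - f s) - y
    = of_real k z^-1 *: (f (s + z) - f s - of_real k z *: y).
  by rewrite [RHS]scalerBr scalerA -of_realM mulVf // of_real1 scale1r of_realV.
rewrite (seminormZ _ _ pc.1) normfV; apply: le_lt_trans (_ : e / 2 < e); last by lra.
by rewrite ler_pdivrMl // normr_gt0.
Qed.

End ChernoffSequence.

(** * The equivalence and the limit formula *)

Theorem theorem7p2 (R : realType) (k : scalar_kind) (X : tvsType (scalars R k))
  (hausX : hausdorff_space X)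
  (Omega : Type) (p : Omega -> X -> R) (pX : generating_seminorms p)
  (Z : partial_operator X) (linZ : linear_operator Z) (denseZ : dense (op_dom Z))
  (t : R) (t0 : 0 < t)
  (F : R -> {linear X -> X}) (FX : chernoff_function p F)
  (domZF : op_dom Z `<=` op_dom (effective_derivative F))
  (ZF : forall g, op_dom Z g -> effective_derivative F g = Z g)
  (l : R) (l0 : 0 < l) (h : X) (domh : op_dom (op_closure Z) h) :
  let cond_a := forall s, 0 <= s < l ->
    subsequentially_compact (@strong_cvg R k X) (chernoff_sequence F t s h) in
  let cond_b := forall s, 0 <= s < l -> exists fs : nat -> X,
    [/\ forall n, op_dom (op_closure Z) (fs n),
        weak_cvg (fun n => chernoff_sequence F t s h n - fs n) 0 &
        subsequentially_compact (@weak_cvg R k X)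
          (fun n => op_closure Z (fs n))] in
  ((exists f : R -> X, local_solution (op_closure Z) l h f) <->
     cond_a /\ cond_b) /\
  (cond_a /\ cond_b ->
   forall f : R -> X, local_solution (op_closure Z) l h f ->
   forall v, 0 <= v < l -> iter n (F (v / n%:R)) h @[n --> \oo] --> f v).
Proof.
move=> cond_a cond_b; have FB := FX.1.
have FF : Filter (\oo : set_system nat) by exact: eventually_filter.
have ZF' g : op_dom Z g -> mv_effective_derivative F g (Z g).
  by move=> Zg; rewrite -ZF //; exact: (@xgetPex _ 0 _ (domZF _ Zg)).
split; [split=> [[f sol]|[ca cb]]|move=> _ f sol v vl].
- have fc s (sl : 0 <= s < l) :=
    orbit_cvg_solution pX denseZ t0 FB ZF' sol sl.
  split=> s sl.
    move=> phi phii; exists id; split=> //; exists (f s).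
    exact: (cvg_comp _ _ (increasing_index_cvg phii) (fc _ sl)).
  exists (fun=> f s); split.
  + by move=> _; case: (sol.2 _ sl).
  + apply: strong_weak_cvg; apply: (seminorm_cvg pX FF) => a e e0.
    have := continuous_seminorm_cvg FF (generating_continuous pX a) (fc _ sl) e0.
    by apply: filterS => n; rewrite subr0.
  + move=> phi phii; exists id; split=> //; exists (op_closure Z (f s)).
    by apply: strong_weak_cvg; exact: cvg_cst.
- have [phi [phii [f fc]]] := orbit_subsequence pX denseZ t0 FB ZF' ca.
  exists f; apply: (orbit_limit_solution hausX pX denseZ t0 FB ZF' l0 domh phii fc).
  move=> s sl; have [fs [fsd ufs fsc]] := cb _ sl.
  exact: (orbit_limit_domain pX linZ phii fsd ufs fsc (fc _ sl)).
(* At [v = 0] the step is 0, outside the range of [mesh_convergence]; every term is then [h]. *)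
- have [v0|v0] := eqVneq v 0.
    rewrite v0 sol.1 (_ : (fun n => _) = fun=> h); first exact: cvg_cst.
    apply/funext => n; rewrite mul0r.
    by elim: n => //= n ->; case: FB.
  have {}v0 : 0 < v by rewrite lt_def v0; case/andP: vl.
  apply: (seminorm_cvg pX FF) => a e e0.
  have [d d0 H] := mesh_convergence pX denseZ FB ZF' a sol vl e0.
  have [N _ nN] := mesh_lt v d0.
  (* [mesh_lt v] concerns the steps [v / n.+1], hence the shift; for such a step [truncn (v / tau)]
     is exactly [n.+1]. *)
  exists N.+1 => // -[//|n] /= nn.
  have := H (v / n.+1%:R); rewrite invf_div mulrCA mulfV ?gt_eqF // mulr1 natrK.
  by apply; rewrite divr_gt0 // nN.
Qed.
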